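(* Let $\mathbb{X}\subseteq\mathbb{P}^2$ be a $\Bbbk$-configuration of type $d=(d_1,\dots,d_s)\neq(1)$. Then there exists an integer $m_0$ such that for all integers $m\geq m_0$, $$\Delta \mathbf{H}_{m\mathbb{X}}(m d_s-1)=\text{the number of lines in }\mathbb{P}^2\text{ containing exactly } d_s \text{ points of }\mathbb{X}.$$ Moreover, if $d_s>s$ one may take $m_0=2$, and if $d_s=s$ one may take $m_0=s+1$.
   Context: $\Bbbk$ is an algebraically closed field and $R=\Bbbk[x_0,x_1,x_2]$. A $\Bbbk$-configuration of type $(d_1,\dots,d_s)$ is a finite set $\mathbb{X}\subseteq\mathbb{P}^2$ for which there exist integers $1\le d_1<\cdots<d_s$, subsets $\mathbb{X}_1,\dots,\mathbb{X}_s$ of $\mathbb{X}$ and distinct lines $\mathbb{L}_1,\dots,\mathbb{L}_s\subseteq\mathbb{P}^2$ such that (1) $\mathbb{X}=\bigcup_{i=1}^s\mathbb{X}_i$; (2) $|\mathbb{X}_i|=d_i$ and $\mathbb{X}_i\subseteq\mathbb{L}_i$ for each $i$; (3) for $1<i\le s$, $\mathbb{L}_i$ contains no point of $\mathbb{X}_j$ for any $j<i$. (Note $d_s\ge s$ always.) For a point $P$, $I_P\subseteq R$ is its homogeneous prime ideal; for $\mathbb{X}=\{P_1,\dots,P_n\}$ and a positive integer $m$, $m\mathbb{X}$ is the fat point scheme defined by $I_{m\mathbb{X}}=I_{P_1}^m\cap\cdots\cap I_{P_n}^m$. For a scheme $\mathbb{Z}$ with ideal $I_\mathbb{Z}$,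 $\mathbf{H}_\mathbb{Z}(t)=\dim_\Bbbk R_t-\dim_\Bbbk (I_\mathbb{Z})_t$ is its Hilbert function, and $\Delta\mathbf{H}_\mathbb{Z}(t)=\mathbf{H}_\mathbb{Z}(t)-\mathbf{H}_\mathbb{Z}(t-1)$ with $\mathbf{H}_\mathbb{Z}(t)=0$ for $t<0$. *)

(* Defs.v *)
From HB Require Import structures.
From mathcomp Require Import all_boot all_order all_algebra.
Set Implicit Arguments. Unset Strict Implicit. Unset Printing Implicit Defensive.
Import Order.TTheory GRing.Theory Num.Theory.
Local Open Scope ring_scope.

Section Defs.
Variable K : fieldType.

(* R = K[x0,x1,x2], realised as nested univariate polynomials:
   x2 is the outer variable, x1 the middle one, x0 the inner one. *)
Definition R3 := {poly {poly {poly K}}}.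
Definition x0 : R3 := ('X%:P)%:P.
Definition x1 : R3 := ('X)%:P.
Definition x2 : R3 := 'X.

Definition coef3 (F : R3) (a b c : nat) : K := ((F`_c)`_b)`_a.

Definition mon (a b c : nat) : R3 := x0 ^+ a * x1 ^+ b * x2 ^+ c.

(* coordinate vector of the degree-t homogeneous component of F,
   indexed by (a,b) with a+b <= t (c = t-a-b); other slots are 0. *)
Definition coefv (t : nat) (F : R3) : 'rV[K]_(t.+1 * t.+1) :=
  mxvec (\matrix_(i < t.+1, j < t.+1)
           if (i + j <= t)%N then coef3 F i j (t - i - j) else 0).

Definition Rspace (t : nat) : 'M[K]_(t.+1 * t.+1) :=
  (\big[addsmx/0]_(i < t.+1) \big[addsmx/0]_(j < t.+1 | (i + j <= t)%N)
     <<coefv t (mon i j (t - i - j))>>)%MS.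

(* points of P^2 and lines of P^2 are nonzero vectors of K^3 up to scalars *)
Definition c0 (P : 'rV[K]_3) := P 0 (@inord 2 0).
Definition c1 (P : 'rV[K]_3) := P 0 (@inord 2 1).
Definition c2 (P : 'rV[K]_3) := P 0 (@inord 2 2).

(* generators of the homogeneous prime ideal I_P of P = [a0:a1:a2] *)
Definition l01 (P : 'rV[K]_3) : R3 := (c0 P)%:P%:P%:P * x1 - (c1 P)%:P%:P%:P * x0.
Definition l02 (P : 'rV[K]_3) : R3 := (c0 P)%:P%:P%:P * x2 - (c2 P)%:P%:P%:P * x0.
Definition l12 (P : 'rV[K]_3) : R3 := (c1 P)%:P%:P%:P * x2 - (c2 P)%:P%:P%:P * x1.

(* (I_P^m)_t : the degree-t part of the ideal I_P^m, which is generated by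
   the products l01^i l02^j l12^k with i+j+k = m; its degree-t part is
   spanned by (monomial of degree t-m) * (such a product). *)
Definition IPm (P : 'rV[K]_3) (m t : nat) : 'M[K]_(t.+1 * t.+1) :=
  if (m <= t)%N then
  (\big[addsmx/0]_(i < m.+1) \big[addsmx/0]_(j < m.+1 | (i + j <= m)%N)
   \big[addsmx/0]_(u < (t - m).+1) \big[addsmx/0]_(v < (t - m).+1 | (u + v <= t - m)%N)
     <<coefv t (mon u v (t - m - u - v) *
                (l01 P ^+ i * l02 P ^+ j * l12 P ^+ (m - i - j)))%R>>)%MS
  else 0.

Definition ImX n (X : 'I_n -> 'rV[K]_3) (m t : nat) : 'M[K]_(t.+1 * t.+1) :=
  (Rspace t :&: \big[capmx/1%:M]_(p < n) IPm (X p) m t)%MS.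

Definition HF n (X : 'I_n -> 'rV[K]_3) (m : nat) (t : int) : int :=
  match t with
  | Posz t' => (\rank (Rspace t'))%:Z - (\rank (ImX X m t'))%:Z
  | Negz _ => 0
  end.

Definition dHF n (X : 'I_n -> 'rV[K]_3) (m : nat) (t : int) : int :=
  HF X m t - HF X m (t - 1).

Definition on_line (P L : 'rV[K]_3) : bool := (P *m L^T) 0 0 == 0.

Definition proj_points n (X : 'I_n -> 'rV[K]_3) : Prop :=
  (forall p, X p != 0) /\ (forall p q, p != q -> ~~ (X p == X q)%MS).

Definition is_kconfig n (X : 'I_n -> 'rV[K]_3) (d : seq nat) : Prop :=
  [/\ (0 < size d)%N, (0 < head 0%N d)%N & sorted ltn d] /\
  exists (Xs : 'I_(size d) -> {set 'I_n}) (L : 'I_(size d) -> 'rV[K]_3),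
    [/\ \bigcup_(i < size d) Xs i = [set: 'I_n] /\
          (forall i, #|Xs i| = nth 0%N d i),
        (forall i, L i != 0),
        (forall i j, i != j -> ~~ (L i == L j)%MS),
        (forall i p, p \in Xs i -> on_line (X p) (L i)) &
        (forall i j : 'I_(size d), (j < i)%N -> forall p, p \in Xs j -> ~~ on_line (X p) (L i))].

Definition count_lines n (X : 'I_n -> 'rV[K]_3) (k N : nat) : Prop :=
  exists Ls : 'I_N -> 'rV[K]_3,
    [/\ (forall j, Ls j != 0),
        (forall j j', j != j' -> ~~ (Ls j == Ls j')%MS),
        (forall j, #|[set p | on_line (X p) (Ls j)]| = k) &
        forall L, L != 0 -> #|[set p | on_line (X p) L]| = k ->
          exists j, (L == Ls j)%MS].

Definition dH_eq_lines n (X : 'I_n -> 'rV[K]_3) (m k : nat) : Prop :=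
  exists N, count_lines X k N /\ dHF X m ((m * k)%N%:Z - 1) = N%:Z.

End Defs.

(* Main.v *)
Require Import Defs.
From HB Require Import structures.
From mathcomp Require Import all_boot all_order all_algebra.
From mathcomp Require Import perm ring zify.
Set Implicit Arguments. Unset Strict Implicit. Unset Printing Implicit Defensive.
Import Order.TTheory GRing.Theory Num.Theory.
Local Open Scope ring_scope.

(* Let Z be a fat point scheme with multiplicities mu, L a line and v the degree of
   Z restricted to L. Restricting forms of degree t to L and dividing by L those that
   vanish on it gives
     dim (I_Z)_t <= dim (I_{Z:L})_(t-1) + max(0, t + 1 - v).
   If a sequence S of lines reduces mX to the empty scheme and v_k is the degree met at
   step k, this bounds the defect deg(mX) - H(t) by the sum of max(0, v_k + k - t - 1).
   In the k-configuration one can choose S with v_k + k <= m d_s for all k, with equality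
   only at lines containing d_s points of X, each counted once. Thus mX imposes independent
   conditions in degree m d_s - 1, and has defect at most N, the number of such lines, in
   degree m d_s - 2. Conversely, by Bezout, these N lines are fixed components of the forms
   of degree m d_s - 2, and removing them shows that the defect there is at least N. *)

(** * Ternary forms *)

(** The bookkeeping decides the two constants. A round through the lines of the configuration takes
    s steps, while it lowers the degree on a line with d_s points by d_s. If d_s > s, every round
    after the first has slack, and only the first can meet the bound m d_s; m >= 2 ensures that
    there a line with fewer points stays strictly below it. If d_s = s, the slack is gone. Then d_i
    = i, so X_1 is a single point, and the lines that join it to the points of X_s may contain s
    points without occurring among the L_i. They take the place of L_1, one in each of s rounds, and
    one more round is needed to profit from the additional hits, whence m >= s + 1. For type (1) the
    count itself would be infinite.

    The ideal I_P^m is given by generators, whereas multiplying and dividing by a line calls for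
    orders of vanishing. The two are matched in every degree by moving P to [1:0:0], with Taylor
    expansions instead of derivatives, so that the characteristic does not matter. *)

Section EvalPoly.
Variables (A : nzRingType) (S : comNzRingType) (f : {rmorphism A -> S}) (a : S).

Definition evp : {poly A} -> S :=
  @horner_morph A S f a (fun x => mulrC a (f x)).
HB.instance Definition _ := GRing.RMorphism.on evp.

Lemma evpX : evp 'X = a.
Proof. exact: horner_morphX. Qed.

Lemma evpC c : evp c%:P = f c.
Proof. exact: horner_morphC. Qed.

End EvalPoly.

Lemma poly_rmorph_ext (A S : nzRingType) (f g : {rmorphism {poly A} -> S}) :
  (forall c, f c%:P = g c%:P) -> f 'X = g 'X -> f =1 g.
Proof.
move=> fgC fgX; elim/poly_ind => [|p c IHp]; first by rewrite !rmorph0.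
by rewrite !rmorphD !rmorphM /= IHp fgC fgX.
Qed.

Section R3Theory.
Variable K : fieldType.
Local Notation R3 := (R3 K).
Local Notation x0 := (@x0 K).
Local Notation x1 := (@x1 K).
Local Notation x2 := (@x2 K).

Definition C3 : K -> R3 := fun c => c%:P%:P%:P.
Fact C3_is_zmod_morphism : zmod_morphism C3.
Proof. by move=> a b; rewrite /C3 !raddfB. Qed.
Fact C3_is_monoid_morphism : monoid_morphism C3.
Proof. by split=> [|a b]; rewrite /C3 ?rmorph1 ?rmorphM. Qed.
HB.instance Definition _ := GRing.isZmodMorphism.Build K R3 C3 C3_is_zmod_morphism.
HB.instance Definition _ := GRing.isMonoidMorphism.Build K R3 C3 C3_is_monoid_morphism.

Definition i0 : 'I_3 := inord 0.
Definition i1 : 'I_3 := inord 1.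
Definition i2 : 'I_3 := inord 2.

Lemma ord3P (i : 'I_3) : [\/ i = i0, i = i1 | i = i2].
Proof.
case: i => [[|[|[|//]]] Hi]; [apply: Or31|apply: Or32|apply: Or33];
 by apply/val_inj; rewrite /= inordK.
Qed.

Lemma i0E : i0 = 0. Proof. by apply/val_inj; rewrite /= inordK. Qed.
Lemma i1E : i1 = 1. Proof. by apply/val_inj; rewrite /= inordK. Qed.
Lemma i2E : i2 = ord_max. Proof. by apply/val_inj; rewrite /= inordK. Qed.

Lemma sum3 (V : nmodType) (f : 'I_3 -> V) : \sum_i f i = f i0 + f i1 + f i2.
Proof.
rewrite !big_ord_recl big_ord0 addr0 addrA i0E i1E i2E.
by congr (f _ + f _ + f _); apply/val_inj.
Qed.

Lemma row3P (T : Type) (V W : 'rV[T]_3) :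
  V 0 i0 = W 0 i0 -> V 0 i1 = W 0 i1 -> V 0 i2 = W 0 i2 -> V = W.
Proof. by move=> h0 h1 h2; apply/rowP => i; case: (ord3P i) => ->. Qed.

Definition xv (i : 'I_3) : R3 := if i == i0 then x0 else if i == i1 then x1 else x2.

Lemma xv0 : xv i0 = x0. Proof. by rewrite /xv eqxx. Qed.
Lemma xv1 : xv i1 = x1. Proof. by rewrite /xv i0E i1E. Qed.
Lemma xv2 : xv i2 = x2. Proof. by rewrite /xv i0E i1E i2E. Qed.

(** The universal property of R over its constants. Its proof is opaque, so every substitution below
    is handled through its values on [C3 c] and [xv i] alone; [R3_ext] gives the matching
    uniqueness. *)
Fact ev_sig (S : comNzRingType) (f : {rmorphism K -> S}) (V : 'I_3 -> S) :
  { g : {rmorphism R3 -> S} | (forall c, g (C3 c) = f c) /\ (forall i, g (xv i) = V i) }.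
Proof.
exists (evp (evp (evp f (V i0)) (V i1)) (V i2)); split=> [c|i] /=.
  by rewrite /C3 evpC /= evpC /= evpC.
case: (ord3P i) => ->; rewrite ?xv0 ?xv1 ?xv2.
- by rewrite /x0 evpC /= evpC /= evpX.
- by rewrite /x1 evpC /= evpX.
- by rewrite /x2 evpX.
Qed.

Definition ev (S : comNzRingType) (f : {rmorphism K -> S}) (V : 'I_3 -> S) :
  {rmorphism R3 -> S} := sval (ev_sig f V).

Lemma evC (S : comNzRingType) (f : {rmorphism K -> S}) V c : ev f V (C3 c) = f c.
Proof. exact: (svalP (ev_sig f V)).1. Qed.
Lemma ev_xv (S : comNzRingType) (f : {rmorphism K -> S}) V i : ev f V (xv i) = V i.
Proof. exact: (svalP (ev_sig f V)).2. Qed.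

Lemma R3_ext (S : nzRingType) (f g : {rmorphism R3 -> S}) :
  (forall c, f (C3 c) = g (C3 c)) -> (forall i, f (xv i) = g (xv i)) -> f =1 g.
Proof.
move=> hC h; have := h i0; have := h i1; have := h i2; rewrite xv0 xv1 xv2 => h2 h1 h0.
apply: (@poly_rmorph_ext {poly {poly K}} S f g) => [c|]; last exact: h2.
apply: (@poly_rmorph_ext {poly K} S (f \o polyC) (g \o polyC)) => [d|]; last exact: h1.
apply: (@poly_rmorph_ext K S (f \o polyC \o polyC) (g \o polyC \o polyC)) => [e|].
  exact: hC.
exact: h0.
Qed.

Lemma coef3D F G a b c : coef3 (F + G : R3) a b c = coef3 F a b c + coef3 G a b c.
Proof. by rewrite /coef3 !coefD. Qed.
Lemma coef3_0 a b c : coef3 (0 : R3) a b c = 0.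
Proof. by rewrite /coef3 !coef0. Qed.
Lemma coef3C k F a b c : coef3 (C3 k * F : R3) a b c = k * coef3 F a b c.
Proof. by rewrite /coef3 !coefCM. Qed.
Lemma coef3_sum I (r : seq I) (P : pred I) (G : I -> R3) a b c :
  coef3 (\sum_(i <- r | P i) G i) a b c = \sum_(i <- r | P i) coef3 (G i) a b c.
Proof. by apply: (big_morph (fun F => coef3 F a b c)) => [F G'|]; rewrite ?coef3D ?coef3_0. Qed.
Lemma coef3_mon a b c i j k :
  coef3 (mon K a b c) i j k = ((i == a) && (j == b) && (k == c))%:R.
Proof.
rewrite /coef3 /mon /x0 /x1 /x2 -!polyC_exp -polyCM coefCM coefXn.
case: (k == c); last by rewrite mulr0 !coef0 andbF.
rewrite mulr1 coefCM coefXn; case: (j == b); last by rewrite mulr0 !coef0 andbF.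
by rewrite mulr1 coefXn !andbT.
Qed.
Lemma coef3P (F G : R3) : (forall a b c, coef3 F a b c = coef3 G a b c) -> F = G.
Proof. by move=> h; do 3 (apply/polyP => ?); apply: h. Qed.

(** Recovers a form from its coordinate vector. Slots with [i + j > t] are dropped, so [hform] is
    injective only on [Rspace K t], the vectors fixed by [hform] followed by [coefv t]
    ([in_Rspace]). *)
Definition hform t (w : 'rV[K]_(t.+1 * t.+1)) : R3 :=
  \sum_(i < t.+1) \sum_(j < t.+1 | (i + j <= t)%N)
     C3 (w 0 (mxvec_index i j)) * mon K i j (t - i - j).

Definition homog t (F : R3) := forall a b c, (a + b + c)%N != t -> coef3 F a b c = 0.

Lemma coef3_hform t w (i j : 'I_t.+1) k : (i + j + k)%N = t ->
  coef3 (hform w) i j k = w 0 (mxvec_index i j).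
Proof.
move=> ijk; rewrite /hform coef3_sum (bigD1 i) //= [X in _ + X]big1 ?addr0; last first.
  move=> i' ni'; rewrite coef3_sum big1 // => j' _.
  have /negPf nii : (i : nat) != i' by rewrite eq_sym.
  by rewrite coef3C coef3_mon nii mulr0.
rewrite coef3_sum (bigD1 j) /=; last by apply: leq_trans (leq_addr k _) _; rewrite ijk.
rewrite big1 ?addr0; last first.
  move=> j' /andP[_ nj']; have /negPf njj : (j : nat) != j' by rewrite eq_sym.
  by rewrite coef3C coef3_mon njj andbF mulr0.
rewrite coef3C coef3_mon !eqxx /=.
have -> : (t - i - j)%N = k by rewrite -subnDA -[X in (X - _)%N]ijk addKn.
by rewrite eqxx mulr1.
Qed.

Lemma homog0 t : homog t 0. Proof. by move=> *; apply: coef3_0. Qed.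
Lemma homogD t F G : homog t F -> homog t G -> homog t (F + G).
Proof. by move=> hF hG a b c h; rewrite coef3D hF ?hG ?addr0. Qed.
Lemma homogC t k F : homog t F -> homog t (C3 k * F).
Proof. by move=> hF a b c h; rewrite coef3C hF ?mulr0. Qed.
Lemma homog_sum t I (r : seq I) (P : pred I) (G : I -> R3) :
  (forall i, P i -> homog t (G i)) -> homog t (\sum_(i <- r | P i) G i).
Proof. by move=> h; apply: big_ind => //; [exact: homog0|exact: homogD]. Qed.
Lemma homog_mon t a b c : (a + b + c)%N = t -> homog t (mon K a b c).
Proof.
move=> abc i j k h; rewrite coef3_mon; case: andP => // -[/andP[/eqP ia /eqP jb] /eqP kc].
by rewrite ia jb kc abc eqxx in h.
Qed.
Lemma homog_hform t w : homog t (@hform t w).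
Proof.
apply: homog_sum => i _; apply: homog_sum => j hij; apply/homogC/homog_mon.
by rewrite -subnDA subnKC.
Qed.

Lemma coefvE t (F : R3) (i j : 'I_t.+1) : coefv t F 0 (mxvec_index i j) =
  if (i + j <= t)%N then coef3 F i j (t - i - j) else 0.
Proof. by rewrite /coefv mxvecE mxE. Qed.

Lemma rV_mxvecP t (v w : 'rV[K]_(t.+1 * t.+1)) :
  (forall i j, v 0 (mxvec_index i j) = w 0 (mxvec_index i j)) -> v = w.
Proof. by move=> h; apply/rowP => k; case/mxvec_indexP: k. Qed.

Lemma coefvD t (F G : R3) : coefv t (F + G) = coefv t F + coefv t G.
Proof. by apply: rV_mxvecP => i j; rewrite mxE !coefvE coef3D; case: ifP; rewrite ?addr0. Qed.
Lemma coefv0 t : coefv t (0 : R3) = 0.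
Proof. by apply: rV_mxvecP => i j; rewrite mxE !coefvE coef3_0; case: ifP. Qed.
Lemma coefvC t k (F : R3) : coefv t (C3 k * F) = k *: coefv t F.
Proof. by apply: rV_mxvecP => i j; rewrite mxE !coefvE coef3C; case: ifP; rewrite ?mulr0. Qed.
Lemma coefv_sum t I (r : seq I) (P : pred I) (G : I -> R3) :
  coefv t (\sum_(i <- r | P i) G i) = \sum_(i <- r | P i) coefv t (G i).
Proof. by apply: (big_morph (coefv t)) => [F G'|]; rewrite ?coefvD ?coefv0. Qed.

Lemma hform_coefv t (F : R3) : homog t F -> hform (coefv t F) = F.
Proof.
move=> hF; apply: coef3P => a b c.
case: (eqVneq (a + b + c)%N t) => [abc|nabc]; last by rewrite hF ?homog_hform.
have ha : (a < t.+1)%N by rewrite ltnS -abc -addnA leq_addr.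
have hb : (b < t.+1)%N by rewrite ltnS -abc addnAC leq_addl.
have := @coef3_hform t (coefv t F) (Ordinal ha) (Ordinal hb) c abc => /= ->.
by rewrite coefvE /= -abc leq_addr -subnDA addKn.
Qed.

Lemma homogP t (F : R3) : homog t F -> exists w, F = @hform t w.
Proof. by move=> /hform_coefv hF; exists (coefv t F). Qed.

Lemma hformD t (v w : 'rV_(t.+1 * t.+1)) : hform (v + w) = hform v + hform w.
Proof.
rewrite /hform -big_split; apply: eq_bigr => i _; rewrite -big_split; apply: eq_bigr => j _.
by rewrite mxE rmorphD mulrDl.
Qed.
Lemma hformZ t k (w : 'rV_(t.+1 * t.+1)) : hform (k *: w) = C3 k * hform w.
Proof.
rewrite /hform mulr_sumr; apply: eq_bigr => i _; rewrite mulr_sumr; apply: eq_bigr => j _.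
by rewrite mxE rmorphM mulrA.
Qed.
Lemma hform0 t : hform (0 : 'rV_(t.+1 * t.+1)) = 0.
Proof. by rewrite -[0](scale0r 0) hformZ rmorph0 mul0r. Qed.

Lemma monM a b c a' b' c' : mon K a b c * mon K a' b' c' = mon K (a + a') (b + b') (c + c').
Proof. by rewrite /mon !exprD; ring. Qed.

Lemma homogM t u F G : homog t F -> homog u G -> homog (t + u)%N (F * G).
Proof.
move=> /homogP[v ->] /homogP[w ->]; rewrite /hform mulr_suml; apply: homog_sum => i _.
rewrite mulr_suml; apply: homog_sum => j ij; rewrite mulr_sumr; apply: homog_sum => i' _.
rewrite mulr_sumr; apply: homog_sum => j' ij'.
rewrite mulrACA -rmorphM monM; apply/homogC/homog_mon.
by lia.
Qed.
Lemma homog_cst k : homog 0 (C3 k).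
Proof.
have e : 1 = mon K 0 0 0 by rewrite /mon !expr0 !mulr1.
by rewrite -[C3 k]mulr1 e; apply/homogC/homog_mon.
Qed.
Lemma homog1 : homog 0 (1 : R3).
Proof. by rewrite -(rmorph1 C3); apply: homog_cst. Qed.
Lemma homogX t F k : homog t F -> homog (t * k)%N (F ^+ k).
Proof.
move=> hF; elim: k => [|k IH]; first by rewrite muln0 expr0; apply: homog1.
by rewrite mulnS exprS; apply: homogM.
Qed.
Lemma homog_xv i : homog 1 (xv i).
Proof.
have e0 : mon K 1 0 0 = x0 by rewrite /mon expr1 !expr0 !mulr1.
have e1 : mon K 0 1 0 = x1 by rewrite /mon expr1 !expr0 mul1r mulr1.
have e2 : mon K 0 0 1 = x2 by rewrite /mon expr1 !expr0 !mul1r.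
by case: (ord3P i) => ->; rewrite ?xv0 ?xv1 ?xv2 -?e0 -?e1 -?e2; apply: homog_mon.
Qed.

Lemma coefv_mon t (i j : 'I_t.+1) : (i + j <= t)%N ->
  coefv t (mon K i j (t - i - j)) = delta_mx 0 (mxvec_index i j).
Proof.
move=> ij; apply: rV_mxvecP => i' j'; rewrite coefvE mxE eqxx /= coef3_mon.
have -> : (mxvec_index i' j' == mxvec_index i j) = (i' == i) && (j' == j).
  by rewrite (inj_eq (@cast_ord_inj _ _ _)) (inj_eq enum_rank_inj).
rewrite -!val_eqE /=; case: eqP => [->|_]; last by case: ifP.
by case: eqP => [->|_]; rewrite /= ?ij ?eqxx //; case: ifP.
Qed.

Lemma RspaceE t : Rspace K t =
  (\sum_(q : 'I_t.+1 * 'I_t.+1 | (q.1 + q.2 <= t)%N)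
     <<delta_mx 0 (mxvec_index q.1 q.2) : 'rV_(t.+1 * t.+1)>>)%MS.
Proof.
rewrite /Rspace pair_big_dep /=; apply: eq_bigr => q hq.
by rewrite coefv_mon.
Qed.

Lemma card_tri t : #|[pred q : 'I_t.+1 * 'I_t.+1 | (q.1 + q.2 <= t)%N]| = 'C(t.+2, 2).
Proof.
rewrite -sum1_card -(pair_big_dep xpredT (fun i j : 'I_t.+1 => (i + j <= t)%N) (fun _ _ => 1%N)) /=.
rewrite -bin2_sum big_nat_recl // add0n big_mkord (reindex_inj rev_ord_inj) /=.
apply: eq_bigr => i _.
rewrite (eq_bigl (fun j : 'I_t.+1 => (j < i.+1)%N)); last first.
  by move=> j /=; have := ltn_ord i; lia.
rewrite -(big_ord_widen t.+1 (fun=> 1%N) (n1 := i.+1)) ?ltn_ord //.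
by rewrite sum1_card card_ord.
Qed.

Lemma rank_Rspace t : \rank (Rspace K t) = 'C(t.+2, 2).
Proof.
rewrite RspaceE (mxdirectP (mxdirect_delta _ _)) /=; last first.
  by move=> [a b] [c e] _ _ /cast_ord_inj/enum_rank_inj.
rewrite -card_tri -sum1_card; apply: eq_bigr => q _.
by rewrite genmxE mxrank_delta.
Qed.

Lemma in_Rspace t w : reflect (coefv t (hform w) = w) (w <= Rspace K t)%MS.
Proof.
apply: (iffP idP) => [|<-].
  rewrite RspaceE => /sub_sumsmxP[u ->].
  apply: (@big_ind _ (fun w => coefv t (hform w) = w)) => [|v v' hv hv'|q hq].
  - by rewrite hform0 coefv0.
  - by rewrite hformD coefvD hv hv'.
  have /sub_rVP[a ->] : (u q *m <<delta_mx 0 (mxvec_index q.1 q.2) : 'rV_(t.+1 * t.+1)>> <= (delta_mx 0 (mxvec_index q.1 q.2) : 'rV[K]_(t.+1 * t.+1)))%MS.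
    by rewrite (submx_trans (submxMl _ _)) ?genmxE.
  rewrite hformZ coefvC; congr (_ *: _).
  rewrite -coefv_mon // hform_coefv //; apply: homog_mon.
  by rewrite -subnDA subnKC.
rewrite RspaceE /hform coefv_sum summx_sub // => i _.
rewrite coefv_sum summx_sub // => j ij.
rewrite coefvC scalemx_sub // coefv_mon //.
by apply: (sumsmx_sup (i, j)) => //; rewrite genmxE.
Qed.

Lemma coefv_Rspace t (F : R3) : (coefv t F <= Rspace K t)%MS.
Proof.
apply/in_Rspace; apply: rV_mxvecP => i j; rewrite !coefvE; case: ifP => // ij.
by rewrite coef3_hform ?coefvE ?ij // -subnDA subnKC.
Qed.

End R3Theory.

(** * Order of vanishing at a point and powers of its ideal *)

Section Order.
Variable K : fieldType.
Local Notation R3 := (R3 K).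
Local Notation C3 := (@C3 K).
Local Notation xv := (@xv K).

Definition linform (L : 'rV[K]_3) : R3 := \sum_j xv j * C3 (L 0 j).

Lemma homog_linform L : homog 1 (linform L).
Proof. by apply: homog_sum => i _; rewrite mulrC; apply/homogC/homog_xv. Qed.

(** Points are row vectors, and this is [F(x U)]. Hence the order of the factors in [lin_subst_comp]
    and the columns of [U] in [lin_subst_xvE]. *)
Definition lin_subst (U : 'M[K]_3) : {rmorphism R3 -> R3} :=
  @ev K (@Defs.R3 K) C3 (fun i => \sum_j xv j * C3 (U j i)).

Lemma lin_substC U c : lin_subst U (C3 c) = C3 c. Proof. exact: evC. Qed.
Lemma lin_subst_xv U i : lin_subst U (xv i) = \sum_j xv j * C3 (U j i). Proof. exact: ev_xv. Qed.

Lemma lin_subst_comp U V F : lin_subst V (lin_subst U F) = lin_subst (V *m U) F.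
Proof.
apply: (@R3_ext _ _ (lin_subst V \o lin_subst U) (lin_subst (V *m U))) => [c|i] /=; first by rewrite !lin_substC.
rewrite !lin_subst_xv rmorph_sum.
under eq_bigr => j _ do rewrite rmorphM lin_substC lin_subst_xv mulr_suml.
rewrite exchange_big; apply: eq_bigr => k _; rewrite mxE rmorph_sum mulr_sumr.
by apply: eq_bigr => j _; rewrite rmorphM mulrA.
Qed.

Lemma lin_subst1 F : lin_subst 1%:M F = F.
Proof.
apply: (@R3_ext _ _ (lin_subst 1%:M) idfun) => [c|i] /=; first by rewrite lin_substC.
rewrite lin_subst_xv.
have h j : true -> xv j * C3 ((1%:M : 'M_3) j i) = if j == i then xv j else 0.
  have -> : (1%:M : 'M[K]_3) j i = (j == i)%:R by rewrite mxE.
  by case: eqP => _ _; [rewrite (rmorph1 C3) mulr1|rewrite (rmorph0 C3) mulr0].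
by rewrite (eq_bigr _ h) -big_mkcond big_pred1_eq.
Qed.

Lemma lin_subst_mon U a b c : lin_subst U (mon K a b c) =
  lin_subst U (xv i0) ^+ a * lin_subst U (xv i1) ^+ b * lin_subst U (xv i2) ^+ c.
Proof. by rewrite /mon !rmorphM !rmorphXn /= xv0 xv1 xv2. Qed.

Lemma lin_subst_xvE U i : lin_subst U (xv i) = linform (col i U)^T.
Proof. by rewrite lin_subst_xv; apply: eq_bigr => j _; rewrite !mxE. Qed.

Lemma homog_lin_subst U t F : homog t F -> homog t (lin_subst U F).
Proof.
move=> /homogP[w ->]; rewrite /hform rmorph_sum; apply: homog_sum => i _.
rewrite rmorph_sum; apply: homog_sum => j ij; rewrite rmorphM /= lin_substC; apply: homogC.
rewrite lin_subst_mon !lin_subst_xvE.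
have e : ((1 * i + 1 * j) + 1 * (t - i - j))%N = t by lia.
by have := homogM (homogM (homogX (k := i) (homog_linform _)) (homogX (k := j) (homog_linform _)))
  (homogX (k := (t - i - j)%N) (homog_linform _)); rewrite e; apply.
Qed.

(* F(P + T x) with T the outer variable: F lies in the symbolic power I_P^m, which
   equals I_P^m, iff its coefficients of T^k vanish for k < m. *)
Definition taylor (P : 'rV[K]_3) : {rmorphism R3 -> {poly R3}} :=
  @ev K {poly (@Defs.R3 K)} (polyC \o C3) (fun i => (C3 (P 0 i))%:P + 'X * (xv i)%:P).

Lemma taylorC P c : taylor P (C3 c) = (C3 c)%:P. Proof. exact: evC. Qed.
Lemma taylor_xv P i : taylor P (xv i) = (C3 (P 0 i))%:P + 'X * (xv i)%:P.
Proof. exact: ev_xv. Qed.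

Lemma taylor_linform P L : taylor P (linform L) = (C3 ((P *m L^T) 0 0))%:P + 'X * (linform L)%:P.
Proof.
rewrite /linform rmorph_sum mxE !rmorph_sum mulr_sumr -big_split; apply: eq_bigr => i _ /=.
by rewrite mxE !rmorphM /= taylorC taylor_xv mulrDl mulrA.
Qed.

(** Both sides are [F(P U + T x U)]: the displacement is transformed together with the point. *)
Lemma taylor_lin_subst P U F : taylor P (lin_subst U F) = map_poly (lin_subst U) (taylor (P *m U) F).
Proof.
apply: (@R3_ext _ _ (taylor P \o lin_subst U) (map_poly (lin_subst U) \o taylor (P *m U))) => [c|i].
  by rewrite /= lin_substC !taylorC map_polyC /= lin_substC.
rewrite /= lin_subst_xvE taylor_linform taylor_xv rmorphD rmorphM /= map_polyX !map_polyC /= lin_substC lin_subst_xvE.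
congr ((C3 _)%:P + _).
by rewrite !mxE; apply: eq_bigr => j _; rewrite !mxE.
Qed.

Definition ordge (m : nat) P F := forall k, (k < m)%N -> (taylor P F)`_k = 0.

Lemma ordge0 P F : ordge 0 P F. Proof. by []. Qed.
Lemma ordgeD m P F G : ordge m P F -> ordge m P G -> ordge m P (F + G).
Proof. by move=> hF hG k km; rewrite rmorphD coefD hF ?hG ?addr0. Qed.
Lemma ordge_0 m P : ordge m P 0.
Proof. by move=> k km; rewrite rmorph0 coef0. Qed.
Lemma ordgeM m m' P F G : ordge m P F -> ordge m' P G -> ordge (m + m') P (F * G).
Proof.
move=> hF hG k km; rewrite rmorphM coefM big1 // => i _.
case: (ltnP i m) => im; first by rewrite hF ?mul0r.
by rewrite hG ?mulr0 //; have := ltn_ord i; lia.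
Qed.
Lemma ordgeX k P F : ordge 1 P F -> ordge k P (F ^+ k).
Proof.
move=> hF; elim: k => [|k IH]; first exact: ordge0.
by rewrite exprS -add1n; apply: ordgeM.
Qed.
Lemma ordgeMl m P F G : ordge m P G -> ordge m P (F * G).
Proof. by move=> h; rewrite -[m]add0n; apply: ordgeM. Qed.

Lemma ordge_l P : [/\ ordge 1 P (l01 P), ordge 1 P (l02 P) & ordge 1 P (l12 P)].
Proof.
have h a b i j : a = P 0 j -> b = P 0 i -> ordge 1 P (C3 b * xv j - C3 a * xv i).
  move=> -> -> [|//] _; rewrite rmorphB !rmorphM /= !taylorC !taylor_xv coefB !coefCM !coefD !coefXM !coefC /=.
  by rewrite !addr0 mulrC subrr.
rewrite /l01 /l02 /l12; split.
- by have := h (c1 P) (c0 P) (i0) i1; rewrite xv0 xv1; apply.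
- by have := h (c2 P) (c0 P) (i0) i2; rewrite xv0 xv2; apply.
- by have := h (c2 P) (c1 P) (i1) i2; rewrite xv1 xv2; apply.
Qed.

Lemma sumsmx_pred (I : finType) (Pr : pred I) n (A : I -> 'M[K]_n) (Q : 'rV[K]_n -> Prop) w :
  Q 0 -> (forall u v, Q u -> Q v -> Q (u + v)) ->
  (forall i, Pr i -> forall u : 'rV_n, (u <= A i)%MS -> Q u) ->
  (w <= \big[addsmx/0]_(i | Pr i) A i)%MS -> Q w.
Proof.
move=> Q0 QD QA /sub_sumsmxP[u ->]; apply: big_ind => // i Pi.
by apply: (QA i) => //; apply: submxMl.
Qed.

(** Easy half of the equivalence between powers and orders: each generator of I_P has order at least
    1 at P, and orders add up under products. The converse is [ordge_IPm]. *)
Lemma IPm_ordge P m t w : (w <= IPm P m t)%MS -> ordge m P (hform w).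
Proof.
rewrite /IPm; case: ifP => [mt|_]; last by rewrite submx0 => /eqP->; rewrite hform0; apply: ordge_0.
have Q0 : ordge m P (hform (0 : 'rV_(t.+1 * t.+1))) by rewrite hform0; apply: ordge_0.
have QD (u v : 'rV_(t.+1 * t.+1)) : ordge m P (hform u) -> ordge m P (hform v) -> ordge m P (hform (u + v)).
  by rewrite hformD; apply: ordgeD.
apply: (sumsmx_pred (Q := fun w => ordge m P (hform w))) => // i _ w1.
apply: (sumsmx_pred (Q := fun w => ordge m P (hform w))) => // j ij w2.
apply: (sumsmx_pred (Q := fun w => ordge m P (hform w))) => // a _ w3.
apply: (sumsmx_pred (Q := fun w => ordge m P (hform w))) => // b ab w4.
rewrite genmxE => /sub_rVP[k ->]; rewrite hformZ; apply: ordgeMl.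
have [h01 h02 h12] := ordge_l P.
have hl : [/\ homog 1 (l01 P), homog 1 (l02 P) & homog 1 (l12 P)].
  rewrite /l01 /l02 /l12 -!xv0 -!xv1 -!xv2; split; rewrite -mulNr -!(rmorphN polyC);
   by apply: homogD; apply/(@homogC K)/homog_xv.
case: hl => hl1 hl2 hl3.
rewrite hform_coefv.
  have e : (i + j + (m - i - j))%N = m by lia.
  apply: ordgeMl; rewrite -[X in ordge X]e.
  by apply: ordgeM; first apply: ordgeM; apply: ordgeX.
have e : (t - m + (1 * i + 1 * j + 1 * (m - i - j)))%N = t by lia.
rewrite -[X in homog X]e.
apply: homogM; first by apply: homog_mon; lia.
by apply: homogM; first apply: homogM; apply: homogX.
Qed.

End Order.

(** * Coordinates adapted to a point or a line *)

Section Coordinates.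
Variable K : fieldType.

Lemma delta_tperm (i j : 'I_3) : delta_mx 0 i = delta_mx 0 j *m tperm_mx i j :> 'rV[K]_3.
Proof.
rewrite -rowE; apply/rowP => k; rewrite !mxE eqxx /=.
by rewrite tpermR eq_sym.
Qed.

(** Read off from the rank factorization of a nonzero row. With [i0] it moves a point to [1:0:0];
    with [i2] it turns a line into x2 = 0. *)
Lemma delta_row_basis (P : 'rV[K]_3) i : P != 0 ->
  exists2 U : 'M[K]_3, U \in unitmx & P = delta_mx 0 i *m U.
Proof.
move=> P0; have rP : \rank P = 1%N by apply/eqP; rewrite eqn_leq rank_leq_row lt0n mxrank_eq0.
have : P = col_ebase P *m pid_mx 1 *m row_ebase P.
  have <- : pid_mx (\rank P) = pid_mx 1 :> 'rV[K]_3 by rewrite rP.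
  by rewrite mulmx_ebase.
rewrite [col_ebase P]mx11_scalar; set k := col_ebase P 0 0 => PE.
have k0 : k != 0.
  have := col_ebase_unit P; rewrite [col_ebase P]mx11_scalar unitmxE det_scalar1.
  by rewrite unitfE.
have e : (pid_mx 1 : 'rV[K]_3) = delta_mx 0 0.
  by apply/rowP => j; rewrite !mxE eqxx andbT eq_sym.
exists (tperm_mx 0 i *m (k *: row_ebase P)).
  by rewrite unitmx_mul unitmx_perm unitmxZ ?unitfE ?row_ebase_unit.
by rewrite mulmxA -delta_tperm {1}PE e mul_scalar_mx -scalemxAl -scalemxAr.
Qed.

End Coordinates.

Section Membership.
Variable K : fieldType.
Local Notation R3 := (R3 K).
Local Notation C3 := (@C3 K).
Local Notation xv := (@xv K).

(** A Koszul relation: a linear form vanishing at p is a combination of the 2 by 2 minors of p and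
    y. The coefficients come from solving for l at the first nonzero coordinate of p. *)
Lemma vanish_comb (S : comNzRingType) (f : {rmorphism K -> S}) (p0 p1 p2 l0 l1 l2 : K) (y0 y1 y2 : S) :
  (p0 != 0) || (p1 != 0) || (p2 != 0) -> p0 * l0 + p1 * l1 + p2 * l2 = 0 ->
  exists a b c, y0 * f l0 + y1 * f l1 + y2 * f l2 =
    f a * (f p0 * y1 - f p1 * y0) + f b * (f p0 * y2 - f p2 * y0)
    + f c * (f p1 * y2 - f p2 * y1).
Proof.
have solve (p l s : K) : p != 0 -> p * l + s = 0 -> l = - (s / p).
  by move=> p_neq0 /eqP; rewrite addr_eq0 => /eqP e; rewrite -mulNr -e mulrAC divff ?mul1r.
have fV p l : p != 0 -> f l = f (l / p) * f p by move=> hp; rewrite -rmorphM divfK.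
have [->|p0_neq0] := eqVneq p0 0; last first.
  rewrite -addrA => _ /(solve _ _ _ p0_neq0) l0E; exists (l1 / p0), (l2 / p0), 0.
  have -> : l0 = - (p1 * (l1 / p0) + p2 * (l2 / p0)) by rewrite l0E; field.
  rewrite (fV p0 l1) // (fV p0 l2) // rmorphN rmorphD !(rmorphM f p1) !(rmorphM f p2) rmorph0; ring.
have [->|p1_neq0] := eqVneq p1 0; last first.
  rewrite addrAC addrC => _ /(solve _ _ _ p1_neq0) l1E; exists (- (l0 / p1)), 0, (l2 / p1).
  have -> : l1 = - (p2 * (l2 / p1)) by rewrite l1E; field.
  rewrite (fV p1 l0) // (fV p1 l2) // !rmorphN !(rmorphM f p2) !rmorph0; ring.
rewrite /= addrC => p2_neq0 /(solve _ _ _ p2_neq0) l2E.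
exists 0, (- (l0 / p2)), (- (l1 / p2)).
have -> : l2 = 0 by rewrite l2E !mul0r addr0 mul0r oppr0.
rewrite (fV p2 l0) // (fV p2 l1) // !rmorphN !rmorph0; ring.
Qed.

Lemma linformE L : linform L = xv i0 * C3 (L 0 i0) + xv i1 * C3 (L 0 i1) + xv i2 * C3 (L 0 i2).
Proof. exact: sum3. Qed.

Lemma linform_vanish (P L : 'rV[K]_3) : P != 0 -> (P *m L^T) 0 0 = 0 ->
  exists a b c, linform L = C3 a * l01 P + C3 b * l02 P + C3 c * l12 P.
Proof.
move=> P0; rewrite mxE sum3 !mxE => PL.
rewrite linformE xv0 xv1 xv2.
apply: (@vanish_comb (@Defs.R3 K) C3) PL.
move: P0; apply: contraNT; rewrite !negb_or !negbK => /andP[/andP[/eqP p0 /eqP p1] /eqP p2].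
by apply/eqP/row3P; rewrite ?p0 ?p1 ?p2 mxE.
Qed.

End Membership.

Section IdealPower.
Variable K : fieldType.
Local Notation R3 := (R3 K).
Local Notation C3 := (@C3 K).
Local Notation xv := (@xv K).

Lemma form_mulr_ids (S : comNzRingType) (k M N A B C l : S) :
  [/\ N * (k * (M * (A * B * C))) = k * ((N * M) * (A * B * C)),
      l * (k * (M * (A * B * C))) = k * (M * ((l * A) * B * C)),
      l * (k * (M * (A * B * C))) = k * (M * (A * (l * B) * C)) &
      l * (k * (M * (A * B * C))) = k * (M * (A * B * (l * C)))].
Proof. by split; ring. Qed.

Lemma form_mulr_id1 (S : comNzRingType) (A B C : S) : 1 * (1 * (A ^+ 0 * B ^+ 0 * C ^+ 0)) = 1.
Proof. by rewrite !expr0 !mul1r. Qed.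

(** The part of degree m + u of I_P^m, with u the degree of the cofactor. As an inductive predicate
    it supports the two moves needed: a form of degree v raises u by v, a line through P raises m by
    one. *)
Inductive ideal_pow (P : 'rV[K]_3) (m u : nat) : R3 -> Prop :=
| Ideal_pow_0 : ideal_pow P m u 0
| Ideal_pow_D F G : ideal_pow P m u F -> ideal_pow P m u G -> ideal_pow P m u (F + G)
| Ideal_pow_gen k a b c i j l : (a + b + c)%N = u -> (i + j + l)%N = m ->
    ideal_pow P m u (C3 k * (mon K a b c * (l01 P ^+ i * l02 P ^+ j * l12 P ^+ l))).

Lemma ideal_pow_coefv P m u t F : (m + u)%N = t -> ideal_pow P m u F -> (coefv t F <= IPm P m t)%MS.
Proof.
move=> mut; elim=> [|{}F G _ hF _ hG|k a b c i j l abc ijl].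
- by rewrite coefv0 sub0mx.
- by rewrite coefvD addmx_sub.
rewrite coefvC scalemx_sub // /IPm.
have -> : (m <= t)%N by lia.
have hi : (i < m.+1)%N by lia.
have hj : (j < m.+1)%N by lia.
have ha : (a < (t - m).+1)%N by lia.
have hb : (b < (t - m).+1)%N by lia.
apply: (sumsmx_sup (Ordinal hi)) => //.
apply: (sumsmx_sup (Ordinal hj)) => /=; first by lia.
apply: (sumsmx_sup (Ordinal ha)) => //.
apply: (sumsmx_sup (Ordinal hb)) => /=; first by lia.
have -> : (t - m - a - b)%N = c by lia.
have -> : (m - i - j)%N = l by lia.
by rewrite genmxE.
Qed.

Lemma ideal_powC P m u k F : ideal_pow P m u F -> ideal_pow P m u (C3 k * F).
Proof.
elim=> [|{}F G _ hF _ hG|k' a b c i j l abc ijl].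
- by rewrite mulr0; apply: Ideal_pow_0.
- by rewrite mulrDr; apply: Ideal_pow_D.
by rewrite (mulrA (C3 k)) -(rmorphM C3); apply: Ideal_pow_gen.
Qed.

Lemma ideal_pow_mon P m u a b c F : ideal_pow P m u F ->
  ideal_pow P m (a + b + c + u) (mon K a b c * F).
Proof.
elim=> [|{}F G _ hF _ hG|k a' b' c' i j l abc ijl].
- by rewrite mulr0; apply: Ideal_pow_0.
- by rewrite mulrDr; apply: Ideal_pow_D.
have [-> _ _ _] := form_mulr_ids (C3 k) (mon K a' b' c') (mon K a b c)
  (l01 P ^+ i) (l02 P ^+ j) (l12 P ^+ l) 0.
by rewrite monM; apply: Ideal_pow_gen => //; lia.
Qed.

Lemma ideal_pow_homog P m u v F G : homog v G -> ideal_pow P m u F -> ideal_pow P m (v + u) (G * F).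
Proof.
move=> /homogP[w ->] hF; rewrite /hform mulr_suml.
apply: big_ind => [||i _]; [exact: Ideal_pow_0|exact: Ideal_pow_D|rewrite mulr_suml].
apply: big_ind => [||j ij]; [exact: Ideal_pow_0|exact: Ideal_pow_D|rewrite -mulrA].
apply: ideal_powC; rewrite -[X in (X + u)%N](_ : (i + j + (v - i - j))%N = v); first exact: ideal_pow_mon.
by lia.
Qed.

Lemma ideal_pow_l P m u F : ideal_pow P m u F ->
  [/\ ideal_pow P m.+1 u (l01 P * F), ideal_pow P m.+1 u (l02 P * F) & ideal_pow P m.+1 u (l12 P * F)].
Proof.
elim=> [|{}F G _ [hF1 hF2 hF3] _ [hG1 hG2 hG3]|k a b c i j l abc ijl].
- by rewrite !mulr0; split; apply: Ideal_pow_0.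
- by split; rewrite mulrDr; apply: Ideal_pow_D.
split.
- have [_ -> _ _] := form_mulr_ids (C3 k) (mon K a b c) 0 (l01 P ^+ i) (l02 P ^+ j) (l12 P ^+ l) (l01 P).
  by rewrite -exprS; apply: Ideal_pow_gen => //; lia.
- have [_ _ -> _] := form_mulr_ids (C3 k) (mon K a b c) 0 (l01 P ^+ i) (l02 P ^+ j) (l12 P ^+ l) (l02 P).
  by rewrite -exprS; apply: Ideal_pow_gen => //; lia.
have [_ _ _ ->] := form_mulr_ids (C3 k) (mon K a b c) 0 (l01 P ^+ i) (l02 P ^+ j) (l12 P ^+ l) (l12 P).
by rewrite -exprS; apply: Ideal_pow_gen => //; lia.
Qed.

Lemma ideal_pow_linform P L m u F : P != 0 -> (P *m L^T) 0 0 = 0 ->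
  ideal_pow P m u F -> ideal_pow P m.+1 u (linform L * F).
Proof.
move=> P0 PL hF; have [a [b [c ->]]] := linform_vanish P0 PL.
have [h1 h2 h3] := ideal_pow_l hF.
rewrite !mulrDl -!mulrA.
by apply: Ideal_pow_D; first apply: Ideal_pow_D; apply: ideal_powC.
Qed.

Lemma ideal_pow_base P u G : homog u G -> ideal_pow P 0 u G.
Proof.
move=> hG.
have mon1 : mon K 0 0 0 = 1 by rewrite /mon !expr0 !mul1r.
have e : 1 = C3 1 * (mon K 0 0 0 * (l01 P ^+ 0 * l02 P ^+ 0 * l12 P ^+ 0)).
  by rewrite mon1 (rmorph1 C3) form_mulr_id1.
have h1 : ideal_pow P 0 0 1 by rewrite e; apply: Ideal_pow_gen.
by have := ideal_pow_homog hG h1; rewrite addn0 (mulr1 G).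
Qed.

Lemma ideal_pow_linformX P L L' j k u G : P != 0 -> (P *m L^T) 0 0 = 0 -> (P *m L'^T) 0 0 = 0 ->
  homog u G -> ideal_pow P (j + k) u (linform L ^+ j * (linform L' ^+ k * G)).
Proof.
move=> P0 PL PL' hG; elim: j => [|j IH]; last first.
  by rewrite exprS -mulrA; apply: ideal_pow_linform.
rewrite expr0 mul1r; elim: k => [|k IH]; first by rewrite expr0 mul1r; apply: ideal_pow_base.
by rewrite exprS -mulrA; apply: ideal_pow_linform.
Qed.

Lemma split_powers (S : comNzRingType) (x y z : S) i j j' k k' :
  x ^+ i * y ^+ (j' + j) * z ^+ (k' + k) = y ^+ j' * (z ^+ k' * (x ^+ i * y ^+ j * z ^+ k)).
Proof. by rewrite !exprD; ring. Qed.

Lemma coefv_term_IPm (P L0 L L' : 'rV[K]_3) m t i j k : P != 0 -> (P *m L^T) 0 0 = 0 -> (P *m L'^T) 0 0 = 0 ->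
  (i + j + k)%N = t -> (m <= j + k)%N ->
  (coefv t (linform L0 ^+ i * linform L ^+ j * linform L' ^+ k)%R <= IPm P m t)%MS.
Proof.
move=> P0 PL PL' ijk mjk.
(* As many factors [linform L] as possible, at most m, are spent on the ideal power, then factors
   [linform L']; what remains joins the cofactor. *)
pose j' := minn j m; pose k' := (m - j')%N.
have ej : (j' + (j - j'))%N = j by lia.
have ek : (k' + (k - k'))%N = k by lia.
have := split_powers (linform L0) (linform L) (linform L') i (j - j') j' (k - k') k'.
rewrite ej ek => ->.
have hG : homog (1 * i + 1 * (j - j') + 1 * (k - k'))%N (linform L0 ^+ i * linform L ^+ (j - j') * linform L' ^+ (k - k')).
  by apply: homogM; first apply: homogM; apply/homogX/homog_linform.
have := ideal_pow_linformX j' k' P0 PL PL' hG.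
have -> : (j' + k')%N = m by lia.
by apply: ideal_pow_coefv; lia.
Qed.

Definition e0 : 'rV[K]_3 := delta_mx 0 i0.

Lemma map_poly_affine (S S' : nzRingType) (f : {rmorphism S -> S'}) a b :
  map_poly f (a%:P + 'X * b%:P) = (f a)%:P + 'X * (f b)%:P.
Proof. by rewrite rmorphD rmorphM /= map_polyX !map_polyC. Qed.

Lemma affine_nat_of_bool (S : comNzRingType) (f : {rmorphism K -> S}) (b : bool) (y : S) :
  (f b%:R)%:P + 'X * (if b then 0 else y)%:P = if b then 1 else 'X * y%:P.
Proof. by case: b; rewrite ?rmorph1 ?rmorph0 ?mulr0 ?addr0 ?add0r. Qed.

Lemma expr_affine (S : comNzRingType) (y z : S) a b c :
  1 ^+ a * ('X * y%:P) ^+ b * ('X * z%:P) ^+ c = 'X^(b + c) * (y ^+ b * z ^+ c)%:P.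
Proof. by rewrite expr1n mul1r !exprMn exprD mulrACA polyCM !polyC_exp. Qed.

Definition kill_x0 : {rmorphism R3 -> R3} :=
  @ev K (@Defs.R3 K) C3 (fun i => if i == i0 then 0 else xv i).
Lemma kill_x0C c : kill_x0 (C3 c) = C3 c. Proof. exact: evC. Qed.
Lemma kill_x0_xv i : kill_x0 (xv i) = if i == i0 then 0 else xv i. Proof. exact: ev_xv. Qed.

(** [F(1, T x1, T x2)]. For F of degree t the coefficient of T^k collects the terms whose exponent
    of x0 is t - k, with x0 set to 1. *)
Definition dehom : {rmorphism R3 -> {poly R3}} :=
  @ev K {poly (@Defs.R3 K)} (polyC \o C3) (fun i => if i == i0 then 1 else 'X * (xv i)%:P).
Lemma dehomC c : dehom (C3 c) = (C3 c)%:P. Proof. exact: evC. Qed.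
Lemma dehom_xv i : dehom (xv i) = if i == i0 then 1 else 'X * (xv i)%:P. Proof. exact: ev_xv. Qed.

Lemma dehomE F : dehom F = map_poly kill_x0 (taylor e0 F).
Proof.
refine (@R3_ext K {poly (@Defs.R3 K)} dehom (map_poly kill_x0 \o taylor e0) _ _ F) => [c|l].
  by rewrite [RHS]/= dehomC taylorC map_polyC; apply: (congr1 polyC (esym (kill_x0C c))).
rewrite [RHS]/= dehom_xv taylor_xv map_poly_affine kill_x0C kill_x0_xv.
have -> : e0 0 l = (l == i0)%:R by rewrite mxE eqxx.
exact: (esym (@affine_nat_of_bool (@Defs.R3 K) C3 (l == i0) (xv l))).
Qed.

Lemma dehom_mon (a b c : nat) : dehom (mon K a b c) = 'X^(b + c) * (mon K 0 b c)%:P.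
Proof.
have -> : mon K a b c = xv i0 ^+ a * xv i1 ^+ b * xv i2 ^+ c by rewrite xv0 xv1 xv2.
have -> : mon K 0 b c = xv i1 ^+ b * xv i2 ^+ c by rewrite /mon expr0 mul1r xv1 xv2.
have h : forall i k, dehom (xv i ^+ k) = (if i == i0 then 1 else 'X * (xv i)%:P) ^+ k.
  by move=> i k; rewrite rmorphXn; congr (_ ^+ _); apply: dehom_xv.
rewrite 2!(rmorphM dehom) 3!h eqxx i1E i2E i0E.
exact: (@expr_affine (@Defs.R3 K)).
Qed.

(* Setting the coordinate x0 of the displacement to 0 dehomogenizes F at [1:0:0]. *)
Lemma ordge_coef m t w (i j : 'I_t.+1) : ordge m e0 (hform w) -> (i + j <= t)%N -> (t - i < m)%N ->
  w 0 (mxvec_index i j) = 0.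
Proof.
move=> hw ij tim.
have h0 : (dehom (hform w))`_(t - i) = 0.
  by rewrite dehomE coef_map (hw _ tim); apply: raddf0.
have hterm (i' j' : 'I_t.+1) : (i' + j' <= t)%N ->
   coef3 ((dehom (C3 (w 0 (mxvec_index i' j')) * mon K i' j' (t - i' - j')))`_(t - i)) 0 j (t - i - j)
    = (w 0 (mxvec_index i' j')) *+ ((i' == i) && (j' == j)).
  move=> ij'; rewrite rmorphM dehomC dehom_mon coefCM coef3C coefXnM.
  have eij : (i' == i) = ((j' + (t - i' - j'))%N == (t - i)%N).
    by rewrite -val_eqE /=; have := ltn_ord i; lia.
  rewrite eij coefC subn_eq0; case: ltngtP => h; rewrite ?coef3_0 ?mulr0 //=.
  rewrite coef3_mon eqxx /= [(j : nat) == _]eq_sym.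
  case: (eqVneq j' j) => [jj|nj]; last first.
    have /negPf -> : (j' : nat) != j by [].
    by rewrite mulr0.
  have -> : (t - i - j == t - i' - j')%N by rewrite jj in h *; lia.
  by rewrite jj eqxx mulr1.
have -> : w 0 (mxvec_index i j) = coef3 ((dehom (hform w))`_(t - i)) 0 j (t - i - j).
  rewrite /hform rmorph_sum coef_sum coef3_sum.
  rewrite (eq_bigr (fun i' => if i' == i then w 0 (mxvec_index i j) else 0)).
    by rewrite -big_mkcond big_pred1_eq.
  move=> i' _; rewrite rmorph_sum coef_sum coef3_sum.
  rewrite (eq_bigr _ (hterm i')); case: eqP => [->|_]; last by rewrite big1.
  rewrite (bigD1 j) // big1 => [|j' /andP[_ /negPf ->]]; last by rewrite andbF.
  by rewrite !eqxx; apply: addr0.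
by rewrite h0 coef3_0.
Qed.

End IdealPower.

(** * Powers of I_P as conditions on the order of vanishing *)

Section Codimension.
Variable K : fieldType.
Local Notation R3 := (R3 K).
Local Notation C3 := (@C3 K).
Local Notation xv := (@xv K).

Lemma coefv_lin_subst V t (w : 'rV[K]_(t.+1 * t.+1)) : coefv t (lin_subst V (hform w)) =
  \sum_(i < t.+1) \sum_(j < t.+1 | (i + j <= t)%N) w 0 (mxvec_index i j) *:
    coefv t (linform (col i0 V)^T ^+ i * linform (col i1 V)^T ^+ j * linform (col i2 V)^T ^+ (t - i - j)).
Proof.
rewrite /hform rmorph_sum coefv_sum; apply: eq_bigr => i _.
rewrite rmorph_sum coefv_sum; apply: eq_bigr => j ij.
by rewrite rmorphM lin_substC coefvC lin_subst_mon !lin_subst_xvE.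
Qed.

Lemma ordge_lin_subst m (P : 'rV[K]_3) U F : ordge m (P *m U) F -> ordge m P (lin_subst U F).
Proof. by move=> h k km; rewrite taylor_lin_subst coef_map (h k km); apply: raddf0. Qed.

(** With P moved to [1:0:0], order at least m kills every coefficient whose exponent of x0 exceeds t
    - m ([ordge_coef]). The monomials that survive have at least m factors vanishing at P, so they
    lie in I_P^m after moving back ([coefv_term_IPm]). *)
Lemma ordge_IPm (P : 'rV[K]_3) m t (w : 'rV[K]_(t.+1 * t.+1)) : P != 0 -> (w <= Rspace K t)%MS ->
  ordge m P (hform w) -> (w <= IPm P m t)%MS.
Proof.
move=> P0 /in_Rspace wR hw; have [U Uu PE] := delta_row_basis i0 P0.
pose V := invmx U.
have PV : P *m V = e0 K by rewrite PE mulmxK.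
have hU : homog t (lin_subst U (hform w)) by apply/homog_lin_subst/homog_hform.
have FE : hform w = lin_subst V (hform (coefv t (lin_subst U (hform w)))).
  by rewrite hform_coefv // lin_subst_comp mulVmx // lin_subst1.
rewrite -wR FE coefv_lin_subst; apply: summx_sub => i _; apply: summx_sub => j ij.
(* [P *m V] is the first coordinate vector, so the other columns of [V] are lines through P. *)
have vanish k : k != i0 -> (P *m ((col k V)^T)^T) 0 0 = 0.
  move=> k0; rewrite trmxK -[RHS](_ : (P *m V) 0 k = 0); last by rewrite PV mxE (negPf k0) andbF.
  by rewrite !mxE; apply: eq_bigr => l _; rewrite !mxE.
case: (ltnP (t - i) m) => tim; last first.
  by apply/scalemx_sub/coefv_term_IPm => //; rewrite ?vanish ?i1E ?i2E ?i0E //; lia.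
have hU' : ordge m (e0 K) (hform (coefv t (lin_subst U (hform w)))).
  by rewrite hform_coefv //; apply: ordge_lin_subst; rewrite -PE.
by rewrite (ordge_coef hU' ij tim) scale0r sub0mx.
Qed.

Lemma mxrank_sums_leq (I : finType) (Pr : pred I) n (A : I -> 'M[K]_n) :
  (\rank (\sum_(i | Pr i) A i)%MS <= \sum_(i | Pr i) \rank (A i))%N.
Proof.
elim/big_rec2: _ => [|i k B _ IH]; first by rewrite mxrank0.
by apply: leq_trans (mxrank_adds_leqif _ _).1 _; rewrite leq_add2l.
Qed.

(** Modulo the ideal, R_t is spanned by the monomials, in coordinates adapted to P, with k < m
    factors vanishing at P: k + 1 of them for each k. For k > t the truncated exponent does no harm,
    as only an upper bound on the rank of [B] is needed. *)
Lemma codim_IPm (P : 'rV[K]_3) m t : P != 0 ->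
  (\rank (Rspace K t) <= \rank (IPm P m t) + 'C(m.+1, 2))%N.
Proof.
move=> P0; have [U Uu PE] := delta_row_basis i0 P0.
pose V := invmx U.
have PV : P *m V = e0 K by rewrite PE mulmxK.
pose l k := linform (col k V)^T.
pose B : 'M[K]_(t.+1 * t.+1) := (\sum_(k < m) \sum_(j < k.+1)
  <<coefv t (l i0 ^+ (t - k) * l i1 ^+ j * l i2 ^+ (k - j))%R>>)%MS.
have rB : (\rank B <= 'C(m.+1, 2))%N.
  apply: leq_trans (mxrank_sums_leq _ _) _.
  rewrite -bin2_sum big_nat_recl // add0n big_mkord; apply: leq_sum => k _.
  apply: leq_trans (mxrank_sums_leq _ _) _.
  rewrite -[X in (_ <= X)%N]card_ord -sum1_card; apply: leq_sum => j _.
  by rewrite genmxE rank_leq_row.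
have sB : (Rspace K t <= IPm P m t + B)%MS.
  apply/rV_subP => w /in_Rspace wR.
  have hU : homog t (lin_subst U (hform w)) by apply/homog_lin_subst/homog_hform.
  have FE : hform w = lin_subst V (hform (coefv t (lin_subst U (hform w)))).
    by rewrite hform_coefv // lin_subst_comp mulVmx // lin_subst1.
  rewrite -wR FE coefv_lin_subst; apply: summx_sub => i _; apply: summx_sub => j ij.
  have vanish k : k != i0 -> (P *m ((col k V)^T)^T) 0 0 = 0.
    move=> k0; rewrite trmxK -[RHS](_ : (P *m V) 0 k = 0); last by rewrite PV mxE (negPf k0) andbF.
    by rewrite !mxE; apply: eq_bigr => q _; rewrite !mxE.
  apply: scalemx_sub.
  case: (ltnP (t - i) m) => tim; last first.
    apply: submx_trans (addsmxSl _ _).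
    by apply: coefv_term_IPm => //; rewrite ?vanish ?i1E ?i2E ?i0E //; lia.
  apply: submx_trans (addsmxSr _ _).
  have hj : (j < (t - i).+1)%N by lia.
  apply: (sumsmx_sup (Ordinal tim)) => //; apply: (sumsmx_sup (Ordinal hj)) => //=.
  have -> : (t - (t - i))%N = i by have := ltn_ord i; lia.
  by rewrite genmxE.
apply: leq_trans (mxrankS sB) _; apply: leq_trans (mxrank_adds_leqif _ _).1 _.
by rewrite leq_add2l.
Qed.

End Codimension.

(** * Restriction to a line *)

Section LinearFactor.
Variable K : fieldType.
Local Notation R3 := (R3 K).
Local Notation C3 := (@C3 K).
Local Notation xv := (@xv K).

Lemma linform_neq0 (L : 'rV[K]_3) : L != 0 -> linform L != 0.
Proof.
apply: contra_neq => L0; apply/rowP => i; rewrite mxE.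
pose f := @ev K K idfun (fun j => (j == i)%:R).
have : f (linform L) = L 0 i.
  rewrite /linform rmorph_sum (bigD1 i) // big1 => [|j /negPf ji].
    by rewrite rmorphM ev_xv evC eqxx mul1r; apply: addr0.
  by rewrite rmorphM ev_xv ji mul0r.
by rewrite L0 => <-; apply: raddf0.
Qed.

Lemma affine_mul_cancel (S : idomainType) (c l : S) (g : {poly S}) m : c != 0 ->
  (forall k, (k < m)%N -> ((c%:P + 'X * l%:P) * g)`_k = 0) ->
  forall k, (k < m)%N -> g`_k = 0.
Proof.
move=> c0 h; elim=> [|k IH] km; have := h _ km;
 rewrite mulrDl coefD coefCM -mulrA coefXM ?coefCM /=.
  by rewrite addr0 => /eqP; rewrite mulf_eq0 (negPf c0) => /eqP.
by rewrite IH ?mulr0 ?addr0; [move=> /eqP; rewrite mulf_eq0 (negPf c0) => /eqP|lia].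
Qed.

Lemma linear_mul_cancel (S : idomainType) (l : S) (g : {poly S}) m : l != 0 ->
  (forall k, (k < m)%N -> ((0%:P + 'X * l%:P) * g)`_k = 0) ->
  forall k, (k < m.-1)%N -> g`_k = 0.
Proof.
move=> l0 h k km; have /h : (k.+1 < m)%N by lia.
by rewrite polyC0 add0r -mulrA coefXM coefCM /= => /eqP; rewrite mulf_eq0 (negPf l0) => /eqP.
Qed.

Lemma C3_neq0 c : c != 0 -> C3 c != 0.
Proof. by rewrite /C3 !polyC_eq0. Qed.

(** The Taylor expansion of the line at P is [L(P) + T L(x)]. Off L its constant term is a nonzero
    scalar, and cancelling it keeps the order; on L it is T times a nonzero form and costs one. *)
Lemma ordge_cancel m (P L : 'rV[K]_3) G : L != 0 -> ordge m P (linform L * G) ->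
  ordge (m - on_line P L) P G.
Proof.
move=> L0 h k.
have h' k' : (k' < m)%N ->
    (((C3 ((P *m L^T) 0 0))%:P + 'X * (linform L)%:P) * taylor P G)`_k' = 0.
  by move=> /h; rewrite rmorphM taylor_linform.
rewrite /on_line; case: eqP => [e|/eqP c0] /=; last first.
  by rewrite subn0; apply: (@affine_mul_cancel (@Defs.R3 K)) h' _; apply: C3_neq0.
rewrite subn1; apply: (@linear_mul_cancel (@Defs.R3 K)) (linform_neq0 L0) _ _.
by move=> k' /h'; rewrite e (rmorph0 C3).
Qed.

Lemma ordge_linform (P L : 'rV[K]_3) : ordge (on_line P L) P (linform L).
Proof.
rewrite /on_line; case: eqP => // e [|//] _.
by rewrite taylor_linform coefD coefXM coefC e addr0 (rmorph0 C3).
Qed.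

Definition mulform (L : 'rV[K]_3) t (w : 'rV[K]_(t.+1 * t.+1)) : 'rV[K]_(t.+2 * t.+2) :=
  coefv t.+1 (linform L * hform w).
Fact mulform_linear L t : linear (@mulform L t).
Proof.
move=> k v w; rewrite /mulform hformD hformZ mulrDr coefvD; congr (_ + _).
by rewrite mulrCA coefvC.
Qed.
HB.instance Definition _ L t := GRing.isLinear.Build K _ _ *:%R (@mulform L t) (@mulform_linear L t).

Lemma hform_mulform L t w : hform (@mulform L t w) = linform L * hform w.
Proof. by apply: hform_coefv; apply: (homogM (homog_linform L) (homog_hform w)). Qed.

Lemma mulform_eq0 L t w : L != 0 -> (w <= Rspace K t)%MS -> @mulform L t w = 0 -> w = 0.
Proof.
move=> L0 /in_Rspace wR w0; have := hform_mulform L w; rewrite w0 hform0 => /esym/eqP.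
rewrite mulf_eq0 (negPf (linform_neq0 L0)) => /eqP hw0.
by rewrite -wR hw0 coefv0.
Qed.

End LinearFactor.

Section Restriction.
Variable K : fieldType.
Local Notation R3 := (R3 K).
Local Notation C3 := (@C3 K).
Local Notation xv := (@xv K).

(** [F(A + T B)]: restriction to the line AB in the chart that leaves out the point B.
    Multiplicities at the other points become multiplicities of roots. *)
Definition line_poly (A B : 'rV[K]_3) : {rmorphism R3 -> {poly K}} :=
  @ev K {poly K} polyC (fun i => (A 0 i)%:P + 'X * (B 0 i)%:P).
Lemma line_polyC A B c : line_poly A B (C3 c) = c%:P. Proof. exact: evC. Qed.
Lemma line_poly_xv A B i : line_poly A B (xv i) = (A 0 i)%:P + 'X * (B 0 i)%:P.
Proof. exact: ev_xv. Qed.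

Lemma size_mulS (p q : {poly K}) a b : (size p <= a.+1)%N -> (size q <= b.+1)%N ->
  (size (p * q)%R <= (a + b).+1)%N.
Proof. by move=> hp hq; apply: leq_trans (size_polyMleq _ _) _; lia. Qed.

Lemma size_exp_affine (p : {poly K}) k : (size p <= 2)%N -> (size (p ^+ k)%R <= k.+1)%N.
Proof.
move=> hp; elim: k => [|k IH]; first by rewrite expr0 size_poly1.
by rewrite exprS; apply: (size_mulS hp IH).
Qed.

Lemma monE i j k : mon K i j k = xv i0 ^+ i * xv i1 ^+ j * xv i2 ^+ k.
Proof. by rewrite xv0 xv1 xv2. Qed.

Lemma mon_x2 i j k : mon K i j k.+1 = xv i2 * mon K i j k.
Proof. by rewrite !monE exprSr mulrA mulrC. Qed.

Lemma rmorph_mon (S : comNzRingType) (f : {rmorphism R3 -> S}) i j k :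
  f (mon K i j k) = f (xv i0) ^+ i * f (xv i1) ^+ j * f (xv i2) ^+ k.
Proof. by rewrite monE 2!(rmorphM f) 3!(rmorphXn f). Qed.

Lemma size_line_poly A B t F : homog t F -> (size (line_poly A B F) <= t.+1)%N.
Proof.
move=> /homogP[w ->]; rewrite /hform rmorph_sum.
apply: leq_trans (size_sum _ _ _) _; apply/bigmax_leqP => i _.
rewrite rmorph_sum; apply: leq_trans (size_sum _ _ _) _; apply/bigmax_leqP => j ij.
rewrite rmorphM line_polyC mul_polyC; apply: leq_trans (size_scale_leq _ _) _.
rewrite rmorph_mon.
have hx l : (size (line_poly A B (xv l)) <= 2)%N.
  rewrite line_poly_xv; apply: leq_trans (size_polyD _ _) _; rewrite geq_max size_polyC.
  by rewrite mulrC mul_polyC (leq_trans (size_scale_leq _ _)) ?size_polyX //; case: eqP.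
have e : (i + j + (t - i - j))%N = t by lia.
rewrite -[X in (_ <= X.+1)%N]e.
by do 2?apply: size_mulS; apply: size_exp_affine.
Qed.

Definition edge_poly : {rmorphism R3 -> {poly K}} :=
  @ev K {poly K} polyC (fun i => if i == i0 then 1 else if i == i1 then 'X else 0).
Lemma edge_polyC c : edge_poly (C3 c) = c%:P. Proof. exact: evC. Qed.
Lemma edge_poly_xv i : edge_poly (xv i) = if i == i0 then 1 else if i == i1 then 'X else 0.
Proof. exact: ev_xv. Qed.

Lemma line_poly_lin_subst U F : line_poly (row i0 U) (row i1 U) F = edge_poly (lin_subst U F).
Proof.
refine (@R3_ext K {poly K} (line_poly _ _) (edge_poly \o lin_subst U) _ _ F) => [c|i].
  by rewrite [RHS]/= lin_substC line_polyC edge_polyC.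
rewrite [RHS]/= lin_subst_xv line_poly_xv rmorph_sum sum3 3!(rmorphM edge_poly) !edge_polyC !edge_poly_xv.
by rewrite !eqxx i0E i1E i2E /= mul1r mul0r addr0 !mxE.
Qed.

Lemma edge_poly_coef t w (i j : 'I_t.+1) : edge_poly (hform w) = 0 -> (i + j)%N = t ->
  w 0 (mxvec_index i j) = 0.
Proof.
move=> w0 ij; have : (edge_poly (hform w))`_j = 0 by rewrite w0 coef0.
have hterm (i' j' : 'I_t.+1) : (i' + j' <= t)%N ->
   (edge_poly (C3 (w 0 (mxvec_index i' j')) * mon K i' j' (t - i' - j')))`_j
    = (w 0 (mxvec_index i' j')) *+ ((i' == i) && (j' == j)).
  move=> ij'; rewrite rmorphM edge_polyC rmorph_mon !edge_poly_xv !eqxx i0E i1E i2E /= expr1n mul1r.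
  rewrite coefCM expr0n subn_eq0.
  case: leqP => h; last first.
    rewrite mulr0 coef0 mulr0 andbC; case: eqP => [jj|//]; case: eqP => // ii.
    by move: h; rewrite ii jj; lia.
  rewrite mulr1 coefXn eq_sym; case: (eqVneq j' j) => [jj|nj]; last first.
    have /negPf -> : (j' : nat) != j by [].
    by rewrite mulr0 andbF.
  rewrite jj eqxx mulr1 andbT.
  have -> : i' == i by apply/eqP/val_inj => /=; rewrite jj in ij' h; lia.
  by [].
rewrite /hform rmorph_sum coef_sum (bigD1 i) //= [X in _ + X]big1 => [|i' ni']; last first.
  by rewrite rmorph_sum coef_sum big1 // => j' ij'; rewrite hterm // (negPf ni').
rewrite rmorph_sum coef_sum (bigD1 j) /= ?ij // big1 => [|j' /andP[ij' nj']]; last first.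
  by rewrite hterm // (negPf nj') andbF.
by rewrite hterm ?ij // !eqxx !addr0.
Qed.

(** After the change of coordinates L becomes x2 and the restriction becomes [F(1, T, 0)], whose
    vanishing says that no term is free of x2. In degree 0 this leaves only F = 0. *)
Lemma line_factor (L : 'rV[K]_3) (U W : 'M[K]_3) t F : W *m U = 1%:M -> col i2 W = L^T ->
  homog t F -> line_poly (row i0 U) (row i1 U) F = 0 ->
  if t is t'.+1 then exists2 G, homog t' G & F = linform L * G else F = 0.
Proof.
move=> WU WL hF; rewrite line_poly_lin_subst => hres.
have [w wE] := homogP (homog_lin_subst U hF).
have FE : F = lin_subst W (hform w) by rewrite -wE lin_subst_comp WU lin_subst1.
rewrite wE in hres.
have xL : linform L = lin_subst W (xv i2) by rewrite lin_subst_xvE WL trmxK.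
have wtop (i j : 'I_t.+1) : (i + j)%N = t -> w 0 (mxvec_index i j) = 0 := edge_poly_coef hres.
clear hF wE hres.
case: t w FE wtop => [|t] w FE wtop.
  rewrite FE.
  rewrite /hform !big_ord_recl !big_ord0 addr0.
  rewrite big_mkcond big_ord_recl big_ord0 wtop //= (rmorph0 C3) mul0r addr0.
  exact: raddf0.
(* Same coefficients, with the exponent of x2 lowered by one; the indices keep the range of [w]. *)
pose G : R3 := \sum_(i < t.+2) \sum_(j < t.+2 | (i + j <= t)%N)
     C3 (w 0 (mxvec_index i j)) * mon K i j (t - i - j).
have hG : homog t G.
  apply: homog_sum => i _; apply: homog_sum => j ij; apply/homogC/homog_mon; lia.
exists (lin_subst W G); first exact: homog_lin_subst.
rewrite FE xL -(rmorphM (lin_subst W)); congr (lin_subst W _).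
rewrite /G mulr_sumr; apply: eq_bigr => i _; rewrite mulr_sumr.
rewrite [LHS]big_mkcond [RHS]big_mkcond; apply: eq_bigr => j _.
case: (ltngtP (i + j) t.+1) => ij.
- have -> : (i + j <= t)%N by lia.
  have -> : (t.+1 - i - j)%N = (t - i - j).+1 by lia.
  by rewrite mon_x2; apply: mulrCA.
- by have -> : (i + j <= t)%N = false by lia.
have -> : (i + j <= t)%N = false by lia.
by rewrite wtop // (rmorph0 C3) mul0r.
Qed.

End Restriction.

(** * Roots of restricted forms *)

Section Divisibility.
Variable K : fieldType.
Local Notation R3 := (R3 K).
Local Notation C3 := (@C3 K).
Local Notation xv := (@xv K).

Definition evK (V : 'rV[K]_3) : {rmorphism R3 -> K} := @ev K K idfun (fun i => V 0 i).
Lemma evKC V c : evK V (C3 c) = c. Proof. exact: evC. Qed.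
Lemma evK_xv V i : evK V (xv i) = V 0 i. Proof. exact: ev_xv. Qed.

Lemma line_poly_taylor (P V : 'rV[K]_3) F : line_poly P V F = map_poly (evK V) (taylor P F).
Proof.
refine (@R3_ext K {poly K} (line_poly P V) (map_poly (evK V) \o taylor P) _ _ F) => [c|i].
  by rewrite [RHS]/= line_polyC taylorC map_polyC; apply: (congr1 polyC (esym (evKC V c))).
by rewrite [RHS]/= taylor_xv map_poly_affine evK_xv evKC line_poly_xv.
Qed.

Lemma line_poly_term (A B : 'rV[K]_3) c i j k : line_poly A B (C3 c * mon K i j k) =
  c%:P * (line_poly A B (xv i0) ^+ i * line_poly A B (xv i1) ^+ j * line_poly A B (xv i2) ^+ k).
Proof. by rewrite (rmorphM (line_poly A B) (C3 c) (mon K i j k)) (line_polyC A B c) (rmorph_mon (line_poly A B) i j k). Qed.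

Lemma expr_scale3 (a : K) (c x y z : {poly K}) i j k :
  c * ((a%:P * x) ^+ i * (a%:P * y) ^+ j * (a%:P * z) ^+ k) =
  (a ^+ (i + j + k))%:P * (c * (x ^+ i * y ^+ j * z ^+ k)).
Proof. by rewrite !exprMn !exprD !polyCM !polyC_exp; ring. Qed.

Lemma line_poly_scale a (A B : 'rV[K]_3) t F : homog t F -> line_poly (a *: A) (a *: B) F = (a ^+ t)%:P * line_poly A B F.
Proof.
move=> /homogP[w ->]; rewrite /hform !rmorph_sum mulr_sumr; apply: eq_bigr => i _.
rewrite !rmorph_sum mulr_sumr; apply: eq_bigr => j ij.
have hx l : line_poly (a *: A) (a *: B) (xv l) = a%:P * line_poly A B (xv l).
  by rewrite !line_poly_xv !mxE !polyCM; ring.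
have e : (i + j + (t - i - j))%N = t by lia.
rewrite (line_poly_term (a *: A)) (line_poly_term A) !hx -[X in a ^+ X]e.
exact: expr_scale3.
Qed.

Lemma line_poly_comp (A B : 'rV[K]_3) r F : line_poly A B F \Po ('X + r%:P) = line_poly (A + r *: B) B F.
Proof.
refine (@R3_ext K {poly K} (comp_poly ('X + r%:P) \o line_poly A B) (line_poly (A + r *: B) B) _ _ F) => [c|i].
  by rewrite [LHS]/= !line_polyC comp_polyC.
rewrite [LHS]/= !line_poly_xv comp_polyD comp_polyM comp_polyX !comp_polyC !mxE polyCD polyCM; ring.
Qed.

(** P has parameter b / a on the line. Translating it to 0 turns the coefficients of the
    restriction, up to powers of a, into the Taylor coefficients at P in the direction B, of which
    the first m vanish. *)
Lemma dvdp_line_poly (P A B : 'rV[K]_3) a b t m F : homog t F -> P = a *: A + b *: B -> a != 0 ->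
  ordge m P F -> ('X - (b / a)%:P) ^+ m %| line_poly A B F.
Proof.
move=> hF PE a0 hm; set r := b / a.
have PE' : P = a *: (A + r *: B) by rewrite scalerDr scalerA mulrCA divff // mulr1.
have h0 k : (k < m)%N -> (line_poly (A + r *: B) B F)`_k = 0.
  move=> km; have := line_poly_taylor P (a *: B) F; rewrite {1}PE' (line_poly_scale _ _ _ hF).
  move=> /(congr1 (fun p : {poly K} => p`_k)); rewrite coefCM coef_map (hm k km).
  move/eqP; rewrite raddf0 mulf_eq0 expf_eq0 (negPf a0) andbF => /eqP; exact.
have -> : line_poly A B F = line_poly (A + r *: B) B F \Po ('X - r%:P).
  rewrite -line_poly_comp -comp_polyA comp_polyD comp_polyX comp_polyC subrK.
  by rewrite comp_polyXr.
rewrite -[line_poly (A + r *: B) B F](poly_take_drop m).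
have -> : take_poly m (line_poly (A + r *: B) B F) = 0.
  apply/polyP => k; rewrite coef_take_poly coef0; case: ifP => // km; exact: h0.
rewrite add0r comp_polyM rmorphXn /= comp_polyX dvdp_mull //.
Qed.

Lemma prod_XsubC_exp_dvdp (I : eqType) (s : seq I) (r : I -> K) (e : I -> nat) (f : {poly K}) :
  uniq s -> {in s &, injective r} ->
  (forall p, p \in s -> ('X - (r p)%:P) ^+ e p %| f) ->
  \prod_(p <- s) ('X - (r p)%:P) ^+ e p %| f.
Proof.
elim: s => [|p s IH] /=; first by rewrite big_nil dvd1p.
move=> /andP[ps us] inj h; rewrite big_cons Gauss_dvdp.
  rewrite h ?mem_head //= IH // => [x y xs ys|q qs].
    by apply: inj; rewrite inE ?xs ?ys orbT.
  by apply: h; rewrite inE qs orbT.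
rewrite coprimep_expl // big_seq; apply: (big_ind (coprimep ('X - (r p)%:P))) => [|x y hx hy|q qs].
- by rewrite coprimep1.
- by rewrite coprimepMr hx hy.
rewrite coprimep_expr // coprimep_XsubC2 // subr_eq0.
apply: contraNneq ps => /inj <- //; first by rewrite inE qs orbT.
by rewrite mem_head.
Qed.

Lemma size_prod_XsubC_exp (I : eqType) (s : seq I) (r : I -> K) (e : I -> nat) :
  size (\prod_(p <- s) ('X - (r p)%:P) ^+ e p) = (\sum_(p <- s) e p).+1.
Proof.
elim: s => [|p s IH]; first by rewrite !big_nil size_poly1.
rewrite !big_cons size_Mmonic.
- by rewrite IH size_exp_XsubC addnS.
- by rewrite monic_neq0 // monic_exp // monicXsubC.
by apply: monic_prod => q _; rewrite monic_exp // monicXsubC.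
Qed.

(** The values are of the form D q with [size q <= u - deg D]. The truncated subtraction is also
    right for deg D >= u, where q = 0. *)
Lemma rank_multiples N u m (A : 'M[K]_(m, N)) (f : {linear 'rV[K]_N -> 'rV[K]_u}) (D : {poly K}) :
  D != 0 ->
  (forall w, (w <= A)%MS -> exists p, [/\ f w = poly_rV p, D %| p & (size p <= u)%N]) ->
  (\rank (A *m lin1_mx f) <= u - (size D).-1)%N.
Proof.
move=> D0 h.
pose B : 'M[K]_(u - (size D).-1, u) := \matrix_i poly_rV (D * 'X^i).
suff /mxrankS/leq_trans : (A *m lin1_mx f <= B)%MS by apply; apply: rank_leq_row.
apply/row_subP => i; rewrite row_mul mul_rV_lin1 /=.
have [p [-> Dp sp]] := h _ (row_sub i A).
rewrite -(divpK Dp) mulrC; set q := p %/ D.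
have sq : (size q <= u - (size D).-1)%N by rewrite size_divp // leq_sub2r.
have -> : q = \sum_(j < u - (size D).-1) q`_j *: 'X^j.
  rewrite -poly_def; apply/polyP => k; rewrite coef_poly; case: ltnP => // hk.
  by rewrite nth_default // (leq_trans sq).
rewrite mulr_sumr linear_sum summx_sub // => j _.
rewrite -scalerAr linearZ scalemx_sub //.
by rewrite -[X in (X <= _)%MS](rowK (fun j : 'I_(u - (size D).-1) => poly_rV (D * 'X^j)) j) row_sub.
Qed.

Definition line_coefs (A B : 'rV[K]_3) t (w : 'rV[K]_(t.+1 * t.+1)) : 'rV[K]_t.+1 :=
  poly_rV (line_poly A B (hform w)).
Fact line_coefs_linear A B t : linear (@line_coefs A B t).
Proof.
move=> k v w; rewrite /line_coefs hformD hformZ rmorphD rmorphM line_polyC mul_polyC.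
exact: linearP.
Qed.
HB.instance Definition _ A B t := GRing.isLinear.Build K _ _ *:%R (@line_coefs A B t) (@line_coefs_linear A B t).

Lemma line_coefs_eq0 A B t w : @line_coefs A B t w = 0 -> line_poly A B (hform w) = 0.
Proof.
move=> /(congr1 rVpoly); rewrite /line_coefs poly_rV_K; last exact/size_line_poly/homog_hform.
by move=> ->; rewrite linear0.
Qed.

End Divisibility.

Section LineBasis.
Variable K : closedFieldType.

Lemma fresh_scalar (s : seq K) : exists z, z \notin s.
Proof.
have /closed_nonrootP[z] : \prod_(a <- s) ('X - a%:P) != 0 :> {poly K}.
  by rewrite monic_neq0 // monic_prod_XsubC.
by rewrite root_prod_XsubC => zs; exists z.
Qed.

Lemma mul_shear (y : 'rV[K]_3) z : let y' := y *m (1%:M - z *: delta_mx i1 i0) in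
  y' 0 i0 = y 0 i0 - z * y 0 i1 /\ y' 0 i1 = y 0 i1.
Proof.
by split; rewrite mxE sum3 !mxE !i0E !i1E !i2E /= ?(mulr0n, mulr1n); ring.
Qed.

(* The second row of U is chosen off the given points, so that none of them is
   at infinity for the parametrization r |-> row i0 U + r *: row i1 U of L. *)
Lemma line_basis (L : 'rV[K]_3) n (X : 'I_n -> 'rV[K]_3) : L != 0 -> (forall p, X p != 0) ->
  exists U W : 'M[K]_3, [/\ W *m U = 1%:M, col i2 W = L^T &
    forall p, on_line (X p) L -> exists a b, a != 0 /\ X p = a *: row i0 U + b *: row i1 U].
Proof.
move=> L0 X0; have [V Vu LE] := delta_row_basis i2 L0.
pose Y p := X p *m V^T.
have VTu : V^T \in unitmx by rewrite unitmx_tr.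
have [z zP] := fresh_scalar [seq Y p 0 i0 / Y p 0 i1 | p <- enum 'I_n].
pose T : 'M[K]_3 := 1%:M + z *: delta_mx i1 i0.
pose T' : 'M[K]_3 := 1%:M - z *: delta_mx i1 i0.
have i10 : i1 != i0 by rewrite i1E i0E.
have i02 : i0 != i2 by rewrite i0E i2E.
have TT : T' *m T = 1%:M.
  rewrite mulmxDr mulmx1 mulmxBl mul1mx -scalemxAl -scalemxAr mul_delta_mx_0 1?eq_sym //.
  by rewrite !scaler0 subr0 subrK.
pose W := V^T *m T'; pose U := T *m invmx V^T.
have UW : U *m W = 1%:M.
  by rewrite /U /W -mulmxA (mulmxA (invmx _)) mulVmx // mul1mx; apply: mulmx1C.
have WU : W *m U = 1%:M by apply: mulmx1C.
have WL : col i2 W = L^T.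
  rewrite colE /W -mulmxA mulmxBl mul1mx -scalemxAl mul_delta_mx_0 // scaler0 subr0.
  by rewrite LE trmx_mul trmx_delta.
exists U, W; split => // p pL.
have XE : X p = (X p *m W) *m U by rewrite -mulmxA WU mulmx1.
have h2 : (X p *m W) 0 i2 = 0.
  rewrite -[LHS](_ : (X p *m col i2 W) 0 0 = _); first by rewrite WL; apply/eqP.
  by rewrite !mxE; apply: eq_bigr => j _; rewrite mxE.
exists ((X p *m W) 0 i0), ((X p *m W) 0 i1); split; last first.
  rewrite {1}XE mulmx_sum_row sum3 h2 scale0r addr0 //.
have [XW0 XW1] : (X p *m W) 0 i0 = Y p 0 i0 - z * Y p 0 i1 /\ (X p *m W) 0 i1 = Y p 0 i1.
  by rewrite /W mulmxA; apply: mul_shear.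
rewrite XW0 subr_eq0; apply/eqP => e.
have [y1|y1] := eqVneq (Y p 0 i1) 0.
  have := X0 p; rewrite XE mulmx_sum_row sum3 h2 XW0 XW1 e y1 subrr !scale0r !addr0.
  by rewrite eqxx.
case/negP: zP; apply/mapP; exists p; first by rewrite mem_enum.
by rewrite e mulfK.
Qed.

End LineBasis.

(** * Fat points and their reduction by lines *)

Section FatPoints.
Variables (K : closedFieldType) (n : nat) (X : 'I_n -> 'rV[K]_3).
Hypothesis X0 : forall p, X p != 0.
Hypothesis Xdist : forall p q, p != q -> ~~ (X p == X q)%MS.

(** The multiplicities vary with the point, since removing a line lowers them only along that line.
    For constant [mu] this is [ImX]. *)
Definition ImXg (mu : 'I_n -> nat) t : 'M[K]_(t.+1 * t.+1) :=
  (Rspace K t :&: \bigcap_(p < n) IPm (X p) (mu p) t)%MS.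

Lemma in_ImXg mu t w : reflect ((w <= Rspace K t)%MS /\ forall p, ordge (mu p) (X p) (hform w))
  (w <= ImXg mu t)%MS.
Proof.
rewrite /ImXg sub_capmx; apply: (iffP andP) => -[wR h]; split=> //.
  by move=> p; move/sub_bigcapmxP: h => /(_ p isT); apply: IPm_ordge.
by apply/sub_bigcapmxP => p _; apply: ordge_IPm.
Qed.

(* Index shift: fdim mu u is the dimension in degree u - 1, so that degree -1 is allowed. *)
Definition fdim mu u : nat := if u is t.+1 then \rank (ImXg mu t) else 0%N.

Definition residual (L : 'rV[K]_3) (mu : 'I_n -> nat) p := (mu p - on_line (X p) L)%N.
Definition line_degree (L : 'rV[K]_3) (mu : 'I_n -> nat) := (\sum_(p | on_line (X p) L) mu p)%N.
Definition fat_degree (mu : 'I_n -> nat) := (\sum_p 'C((mu p).+1, 2))%N.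

(** At each point of L this is C(k + 1, 2) = C(k, 2) + k; a point of multiplicity 0 contributes
    nothing, in accordance with the truncation in [residual]. *)
Lemma fat_degree_residual L mu : fat_degree mu = (fat_degree (residual L mu) + line_degree L mu)%N.
Proof.
rewrite /fat_degree /line_degree [X in (_ + X)%N]big_mkcond -big_split; apply: eq_bigr => p _ /=.
rewrite /residual; case: on_line => /=; last by rewrite subn0 addn0.
by case: (mu p) => [|k]; rewrite ?subn1 //= binS bin1.
Qed.

Lemma mulform_ImXg L mu t w : (w <= ImXg (residual L mu) t)%MS -> (mulform L w <= ImXg mu t.+1)%MS.
Proof.
move=> /in_ImXg[wR hw]; apply/in_ImXg; split; first exact: coefv_Rspace.
move=> p; rewrite hform_mulform => k km.
have h := ordgeM (@ordge_linform _ (X p) L) (hw p); apply: (h k).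
by rewrite /residual; lia.
Qed.

Lemma rank_mulform L t m (A : 'M_(m, _)) : L != 0 -> (A <= Rspace K t)%MS ->
  \rank (A *m lin1_mx (@mulform K L t)) = \rank A.
Proof.
move=> L0 AR; rewrite -[RHS](mxrank_mul_ker A (lin1_mx (@mulform K L t))).
suff -> : (A :&: kermx (lin1_mx (@mulform K L t)))%MS = 0 by rewrite mxrank0 addn0.
apply/eqP; rewrite -submx0; apply/rV_subP => w; rewrite sub_capmx => /andP[wA].
move=> /sub_kermxP; rewrite mul_rV_lin1 => w0.
by rewrite (mulform_eq0 L0 (submx_trans wA AR) w0) sub0mx.
Qed.

Lemma fdim_residual_le L mu u : L != 0 -> (fdim (residual L mu) u.-1 <= fdim mu u)%N.
Proof.
move=> L0; case: u => [|[|t]] //=.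
rewrite -(rank_mulform L0 (capmxSl _ _ : (ImXg (residual L mu) t <= Rspace K t)%MS)).
apply: mxrankS; apply/row_subP => i; rewrite row_mul mul_rV_lin1 /=.
exact/mulform_ImXg/row_sub.
Qed.

(** Restriction to L sends the forms in question to multiples of a polynomial [D], in which each
    point of L is a root with its multiplicity. The kernel is L times the forms of the residual
    scheme. *)
Lemma fdim_restriction L mu u : L != 0 -> (fdim mu u <= fdim (residual L mu) u.-1 + (u - line_degree L mu))%N.
Proof.
move=> L0; case: u => [//|t] /=.
have [U [W [WU WL hX]]] := line_basis L0 X0.
pose A := row i0 U; pose B := row i1 U.
have /fin_all_exists[ab hab] : forall p, exists ab : K * K, on_line (X p) L ->
    ab.1 != 0 /\ X p = ab.1 *: A + ab.2 *: B.
  move=> p; case e: (on_line (X p) L); last by exists (0, 0).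
  by have [a [b h]] := hX p e; exists (a, b).
pose r p := (ab p).2 / (ab p).1.
pose s := [seq p <- enum 'I_n | on_line (X p) L].
have sP p : p \in s = on_line (X p) L by rewrite mem_filter mem_enum andbT.
pose D : {poly K} := \prod_(p <- s) ('X - (r p)%:P) ^+ mu p.
have sD : size D = (line_degree L mu).+1.
  by rewrite size_prod_XsubC_exp big_filter big_enum_cond.
have D0 : D != 0 by rewrite -size_poly_gt0 sD.
pose M := lin1_mx (@line_coefs K A B t).
rewrite -(mxrank_mul_ker (ImXg mu t) M) addnC; apply: leq_add; last first.
  have -> : line_degree L mu = (size D).-1 by rewrite sD.
  apply: rank_multiples => // w /in_ImXg[wR hw].
  exists (line_poly A B (hform w)); split=> //; last exact/size_line_poly/homog_hform.
  rewrite /D; apply: (@prod_XsubC_exp_dvdp K _ s r mu) => [|p q|p].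
  - by rewrite filter_uniq // enum_uniq.
  (* Equal parameters would make the two rows proportional, hence the points equal. *)
  - rewrite !sP => /hab[p0 pE] /hab[q0 qE] rpq.
    have e q' : (ab q').1 != 0 -> X q' = (ab q').1 *: A + (ab q').2 *: B ->
        X q' = (ab q').1 *: (A + r q' *: B).
      by move=> h ->; rewrite scalerDr scalerA mulrCA divff // mulr1.
    apply/eqP; apply: contraT => /Xdist /negP; case.
    rewrite (e p p0 pE) (e q q0 qE) rpq.
    apply/eqmxP; exact: eqmx_trans (eqmx_scale _ p0) (eqmx_sym (eqmx_scale _ q0)).
  rewrite sP => /hab[p0 pE]; exact: dvdp_line_poly (homog_hform w) pE p0 (hw p).
have hker w : (w <= ImXg mu t :&: kermx M)%MS ->
    [/\ (w <= Rspace K t)%MS, forall p, ordge (mu p) (X p) (hform w) & line_poly (row i0 U) (row i1 U) (hform w) = 0].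
  rewrite sub_capmx => /andP[/in_ImXg[wR hw] /sub_kermxP]; rewrite mul_rV_lin1 => /line_coefs_eq0.
  by split.
case: t M hker => [|t] M hker.
  (* A form of degree 0 that vanishes on L is 0. *)
  rewrite leqn0 mxrank_eq0 -submx0; apply/rV_subP => w /hker[/in_Rspace wR _ w0].
  have /= h0 := line_factor WU WL (homog_hform w) w0.
  by rewrite -wR h0 coefv0 sub0mx.
apply: (@leq_trans (\rank (ImXg (residual L mu) t *m lin1_mx (@mulform K L t)))); last exact: mxrankM_maxl.
apply: mxrankS; apply/rV_subP => w /hker[/in_Rspace wR hw w0].
have [G hG FE] := line_factor WU WL (homog_hform w) w0.
have wE : w = mulform L (coefv t G) by rewrite /mulform hform_coefv // -FE wR.
rewrite wE -(mul_rV_lin1 (@mulform K L t)); apply: submxMr.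
apply/in_ImXg; split=> [|p]; first exact: coefv_Rspace.
rewrite hform_coefv //; apply: ordge_cancel => //.
by rewrite -FE; apply: hw.
Qed.

Lemma IPm_Rspace P m t : (IPm P m t <= Rspace K t)%MS.
Proof.
rewrite /IPm; case: ifP => _; last exact: sub0mx.
apply/sumsmx_subP => i _; apply/sumsmx_subP => j _.
apply/sumsmx_subP => a _; apply/sumsmx_subP => b _.
by rewrite genmxE coefv_Rspace.
Qed.

(** The points are imposed one at a time, and each costs at most C(mu p + 1, 2) dimensions by
    [codim_IPm]. *)
Lemma fdim_ge mu u : ('C(u.+1, 2) <= fdim mu u + fat_degree mu)%N.
Proof.
case: u => [//|t] /=; rewrite -(rank_Rspace K) /fat_degree /ImXg.
suff h (s : seq 'I_n) : (\rank (Rspace K t) <=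
    \rank (Rspace K t :&: \bigcap_(p <- s) IPm (X p) (mu p) t)%MS + \sum_(p <- s) 'C((mu p).+1, 2))%N.
  exact: h.
elim: s => [|p s IH].
  by rewrite !big_nil addn0 mxrankS // sub_capmx submx_refl submx1.
rewrite !big_cons; apply: leq_trans IH _.
rewrite addnA leq_add2r.
set S := (\bigcap_(q <- s) _)%MS; set I := IPm _ _ _.
have h1 := codim_IPm (mu p) t (X0 p); rewrite -/I in h1.
have IR : (I <= Rspace K t)%MS := IPm_Rspace _ _ _.
have := mxrank_sum_cap (Rspace K t :&: S)%MS I.
have : (\rank ((Rspace K t :&: S) + I)%MS <= \rank (Rspace K t))%N.
  by apply: mxrankS; rewrite addsmx_sub capmxSl.
have : (\rank ((Rspace K t :&: S) :&: I)%MS <= \rank (Rspace K t :&: (I :&: S))%MS)%N.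
  apply: mxrankS; rewrite !sub_capmx capmxSr.
  by rewrite (submx_trans (capmxSl _ _) (capmxSl _ _)) (submx_trans (capmxSl _ _) (capmxSr _ _)).
lia.
Qed.

End FatPoints.

(** * Incidence of points and lines *)

Section Incidence.
Variables (K : fieldType) (n : nat) (X : 'I_n -> 'rV[K]_3).
Hypothesis XP : proj_points X.

(** Distinct points give a 2 by 3 matrix of rank 2, and each of the two lines spans the same
    one-dimensional kernel. *)
Lemma line_through_inj (L L' : 'rV[K]_3) p q : L != 0 -> L' != 0 -> p != q ->
  on_line (X p) L -> on_line (X q) L -> on_line (X p) L' -> on_line (X q) L' ->
  (L == L')%MS.
Proof.
move=> L0 L'0 pq pL qL pL' qL'.
pose A := col_mx (X p) (X q).
have rX r : \rank (X r) = 1%N.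
  by apply/eqP; rewrite eqn_leq rank_leq_row lt0n mxrank_eq0 XP.1.
have rA : \rank A = 2.
  apply/eqP; rewrite eqn_leq rank_leq_row ltnNge; apply/negP => rA.
  case/negP: (XP.2 _ _ pq).
  have h r : (X r <= A)%MS -> (X r == A)%MS.
    by move=> rs; rewrite -(mxrank_leqif_eq rs).2 eqn_leq mxrankS //= rX.
  have /eqmxP hp : (X p == A)%MS by apply: h; rewrite -addsmxE addsmxSl.
  have /eqmxP hq : (X q == A)%MS by apply: h; rewrite -addsmxE addsmxSr.
  by apply/eqmxP; exact: eqmx_trans hp (eqmx_sym hq).
have hM M : M != 0 -> on_line (X p) M -> on_line (X q) M -> (M == kermx A^T)%MS.
  move=> M0 /eqP pM /eqP qM.
  have MA : (M <= kermx A^T)%MS.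
    apply/sub_kermxP; rewrite -[LHS]trmxK trmx_mul trmxK mul_col_mx.
    rewrite [X p *m _]mx11_scalar [X q *m _]mx11_scalar pM qM.
    by rewrite !raddf0 col_mx0 trmx0.
  rewrite -(mxrank_leqif_eq MA).2 mxrank_ker mxrank_tr rA.
  by rewrite eqn_leq rank_leq_row lt0n mxrank_eq0.
by apply/eqmxP; apply: eqmx_trans (eqmxP (hM _ L0 pL qL)) (eqmx_sym (eqmxP (hM _ L'0 pL' qL'))).
Qed.

Lemma line_through_exists p q : exists L : 'rV[K]_3, [/\ L != 0, on_line (X p) L & on_line (X q) L].
Proof.
pose A := col_mx (X p) (X q).
have : kermx A^T != 0.
  rewrite -mxrank_eq0 mxrank_ker mxrank_tr -lt0n subn_gt0.
  by apply: leq_ltn_trans (rank_leq_row _) _.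
case/rowV0Pn => L /sub_kermxP; rewrite tr_col_mx mul_mx_row => /eqP.
rewrite row_mx_eq0 => /andP[/eqP Lp /eqP Lq] L0; exists L; split=> //;
 by rewrite /on_line -[_ *m _]trmxK trmx_mul trmxK ?Lp ?Lq trmx0 mxE.
Qed.

Lemma card_line_cap (L L' : 'rV[K]_3) : L != 0 -> L' != 0 -> ~~ (L == L')%MS ->
  (#|[pred p | on_line (X p) L & on_line (X p) L']| <= 1)%N.
Proof.
move=> L0 L'0 LL'; apply/card_le1_eqP => p q; rewrite !inE => /andP[pL pL'] /andP[qL qL'].
by apply/eqP; apply: contraNT LL' => pq; rewrite (line_through_inj L0 L'0 pq).
Qed.

(** Removing the lines of [S] from mX leaves multiplicity [m - hits S p] at p, truncated at 0, in
    whatever order they are removed. *)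
Definition hits (S : seq 'rV[K]_3) p := count (on_line (X p)) S.

Lemma sum_hits (A : pred 'I_n) S :
  (\sum_(p | A p) hits S p)%N = (\sum_(L <- S) #|[pred p | A p & on_line (X p) L]|)%N.
Proof.
elim: S => [|L S IH]; first by rewrite big_nil big1.
rewrite big_cons -IH /hits /= big_split /=; congr (_ + _)%N.
rewrite -sum1_card [RHS]big_mkcondr /=; apply: eq_bigr => p _.
by case: on_line.
Qed.

End Incidence.

(** * Upper and lower bounds on the defect *)

Section Reduction.
Variables (K : closedFieldType) (n : nat) (X : 'I_n -> 'rV[K]_3).
Hypothesis XP : proj_points X.

(** An upper bound on the defect in degree u - 1. From step k = u on, the truncated [u - k] is 0 and
    the whole degree v_k is counted, as no forms remain. *)
Fixpoint excess (mu : 'I_n -> nat) u (S : seq 'rV[K]_3) : nat :=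
  if S is L :: S' then (line_degree X L mu - u + excess (residual X L mu) u.-1 S')%N else 0%N.

Lemma eq_line_degree L mu nu : mu =1 nu -> line_degree X L mu = line_degree X L nu.
Proof. by move=> e; apply: eq_bigr => p _; rewrite e. Qed.

Lemma excessE mu u S : excess mu u S =
  (\sum_(k < size S) (line_degree X (nth 0%R S k) (fun p => mu p - hits X (take k S) p) - (u - k)))%N.
Proof.
elim: S mu u => [|L S IH] mu u /=; first by rewrite big_ord0.
rewrite big_ord_recl /= subn0 IH; congr (_ + _)%N.
  by congr (_ - _)%N; apply: eq_line_degree => p; rewrite subn0.
apply: eq_bigr => k _; rewrite /bump /= add1n; congr (_ - _)%N; last by lia.
by apply: eq_line_degree => p; rewrite /residual /= subnDA.
Qed.

(** In one step [fdim] loses at most max(0, u - v), the degree of the scheme loses v and the number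
    C(u + 1, 2) of monomials loses u, so the defect loses at most max(0, v - u). When the lines are
    used up the scheme is empty and the defect is at most 0. *)
Lemma fdim_le_excess mu u S : (forall L, L \in S -> L != 0) -> (forall p, mu p <= hits X S p)%N ->
  (fdim X mu u + fat_degree mu <= 'C(u.+1, 2) + excess mu u S)%N.
Proof.
elim: S mu u => [|L S IH] mu u S0 muS /=.
  have -> : fat_degree mu = 0%N.
    by rewrite /fat_degree big1 // => p _; have := muS p; rewrite leqn0 => /eqP ->.
  rewrite !addn0; case: u => [//|t] /=.
  by rewrite -(rank_Rspace K); apply/mxrankS/capmxSl.
have L0 : L != 0 by apply: S0; rewrite mem_head.
have := IH (residual X L mu) u.-1 _ _; rewrite (fat_degree_residual X L mu) => h.
have {}h := h (fun M MS => S0 M (mem_behead (s := L :: S) MS)) _.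
have := fdim_restriction XP.1 XP.2 mu u L0.
have : ('C(u.-1.+1, 2) + u = 'C(u.+1, 2))%N by case: (u) => //= k; rewrite [RHS]binS bin1.
have := h _; have hh p : (residual X L mu p <= hits X S p)%N.
  by have := muS p; rewrite /residual /hits /=; lia.
move=> /(_ hh); lia.
Qed.

(** Multiplying by the removed lines already yields enough forms, so the embedding
    [fdim_residual_le] suffices. A line met in degree v >= u + 1 lowers the degree of the scheme by
    v and the number of monomials by only u, and so accounts for at least one unit of defect. What
    is left at the end has nonnegative defect by [fdim_ge]. *)
Lemma fdim_ge_heavy mu u S : (forall L, L \in S -> L != 0) ->
  (forall k, (k < size S)%N ->
     (u - k < line_degree X (nth 0%R S k) (fun p => mu p - hits X (take k S) p)%N)%N) ->
  ('C(u.+1, 2) + size S <= fdim X mu u + fat_degree mu)%N.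
Proof.
elim: S mu u => [|L S IH] mu u S0 h /=; first by rewrite addn0; apply: fdim_ge XP.1 _ _.
have L0 : L != 0 by apply: S0; rewrite mem_head.
have := fdim_residual_le XP.1 mu u L0; rewrite (fat_degree_residual X L mu).
have := h 0%N isT; rewrite /= subn0 (eq_line_degree _ (nu := mu)); last by move=> p; rewrite subn0.
have : ('C(u.-1.+1, 2) + u = 'C(u.+1, 2))%N by case: (u) => //= k; rewrite [RHS]binS bin1.
have := IH (residual X L mu) u.-1 (fun M MS => S0 M (mem_behead (s := L :: S) MS)) _.
have hh k : (k < size S)%N ->
    (u.-1 - k < line_degree X (nth 0%R S k) (fun p => residual X L mu p - hits X (take k S) p)%N)%N.
  move=> kS; have := h k.+1 kS; rewrite /=.
  rewrite (eq_line_degree _ (nu := fun p => residual X L mu p - hits X (take k S) p)%N); first by (have -> : (u.-1 - k = u - k.+1)%N by lia).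
  by move=> p; rewrite /residual /= subnDA.
move=> /(_ hh); move: (size S) => N; lia.
Qed.

Definition full k (L : 'rV[K]_3) := #|[set p | on_line (X p) L]| == k.

(** mX has degree m k on such a line, and each of the j lines removed before shares at most one
    point of X with it, so at most j is lost. *)
Lemma full_heavy m k (Fs : seq 'rV[K]_3) j : (forall L, L \in Fs -> L != 0) ->
  pairwise (fun L L' => ~~ (L == L')%MS) Fs -> all (full k) Fs -> (j < size Fs)%N ->
  (m * k <= line_degree X (nth 0%R Fs j) (fun p => m - hits X (take j Fs) p) + j)%N.
Proof.
move=> F0 Fpw Ffull jF; set L := nth _ _ _.
have LF : L \in Fs by apply: mem_nth.
have -> : (m * k = \sum_(p | on_line (X p) L) m)%N.
  rewrite sum_nat_const mulnC; congr (_ * _)%N.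
  by have /allP/(_ _ LF)/eqP <- := Ffull; apply: eq_card => p; rewrite inE.
have hc : (\sum_(p | on_line (X p) L) hits X (take j Fs) p <= j)%N.
  rewrite sum_hits; apply: (@leq_trans (\sum_(M <- take j Fs) 1)%N); last first.
    by rewrite sum1_size size_take jF.
  rewrite big_seq [X in (_ <= X)%N]big_seq; apply: leq_sum => M Mj.
  have MF := mem_take Mj.
  apply: card_line_cap => //; [exact: F0|exact: F0|].
  move: Fpw; rewrite -(cat_take_drop j Fs) pairwise_cat => /andP[/allrelP/(_ M L Mj) h _].
  rewrite andbC; apply: h.
  by rewrite (drop_nth 0) // mem_head.
apply: leq_trans (leq_add (leqnn _) hc); rewrite /line_degree -big_split /=.
by apply: leq_sum => p _; lia.
Qed.

Lemma reduction_dHF m k (Fs S : seq 'rV[K]_3) (V : nat -> nat) :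
  (1 < m * k)%N ->
  (forall L, L \in Fs -> L != 0) ->
  pairwise (fun L L' => ~~ (L == L')%MS) Fs -> all (full k) Fs -> (size Fs <= m * k)%N ->
  (forall L, L \in S -> L != 0) -> (forall p, m <= hits X S p)%N ->
  (forall j, V j = line_degree X (nth 0%R S j) (fun p => m - hits X (take j S) p)%N) ->
  (forall j, j < size S -> V j + j <= m * k)%N ->
  (\sum_(j < size S) (V j + j == m * k) <= size Fs)%N ->
  dHF X m ((m * k)%N%:Z - 1) = (size Fs)%:Z.
Proof.
move=> mk F0 Fpw Ffull Fs_mk S0 mS VE VS Vcount.
move: mk Fs_mk VS Vcount (@full_heavy m k Fs); move: (m * k)%N => T mk Fs_mk VS Vcount heavy.
(* Index [T] of [fdim] means degree T - 1, where all terms of the excess vanish. *)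
have hu1 : (fdim X (fun=> m) T + fat_degree (fun _ : 'I_n => m) <= 'C(T.+1, 2))%N.
  apply: leq_trans (fdim_le_excess T S0 mS) _; rewrite excessE big1 ?addn0 // => j _.
  by rewrite -VE; apply/eqP; rewrite subn_eq0; have := VS j (ltn_ord j); lia.
(* In degree T - 2 a term is at most 1, and it is 0 unless [V j + j = T]. *)
have hu2 : (fdim X (fun=> m) T.-1 + fat_degree (fun _ : 'I_n => m) <= 'C(T.-1.+1, 2) + size Fs)%N.
  apply: leq_trans (fdim_le_excess T.-1 S0 mS) _; rewrite leq_add2l.
  apply: leq_trans Vcount; rewrite excessE; apply: leq_sum => j _.
  rewrite -VE; have := VS j (ltn_ord j); move: (V j) (nat_of_ord j) => v i h.
  by case: (eqVneq (v + i)%N T) => e /=; lia.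
have hl1 := fdim_ge XP.1 (fun=> m) T.
have hl2 : ('C(T.-1.+1, 2) + size Fs <= fdim X (fun=> m) T.-1 + fat_degree (fun _ : 'I_n => m))%N.
  apply: fdim_ge_heavy => // j jF; have := heavy j F0 Fpw Ffull jF.
  by move: (line_degree _ _ _) (leq_trans jF Fs_mk) => v; lia.
have dT : ('C(T.-1.+1, 2) + T = 'C(T.+1, 2))%N by case: (T) mk => // q _; rewrite [RHS]binS bin1.
(* Since [1 < T], both degrees are nonnegative; the degree of mX cancels in the difference of the
   two Hilbert functions. *)
case: T mk {heavy Fs_mk VS Vcount} hu1 hu2 hl1 hl2 dT => [//|[//|T]] _ /= hu1 hu2 hl1 hl2 dT.
have -> : T.+2%:Z - 1 = T.+1%:Z :> int by lia.
have eT : T.+1%:Z - 1 = T%:Z :> int by lia.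
rewrite /dHF eT /HF.
rewrite -/(ImXg X (fun=> m) T.+1) -/(ImXg X (fun=> m) T) !rank_Rspace.
move: hu1 hu2 hl1 hl2 dT; move: (fat_degree _) (\rank (ImXg _ _ T.+1)) (\rank (ImXg _ _ T)) (size Fs).
move: 'C(T.+3, 2) 'C(T.+2, 2) => b c f x y z hu1 hu2 hl1 hl2 dT.
lia.
Qed.

End Reduction.

(** * Choice of the lines for k-configurations *)

(** For rounds through s lines: each of the r full rounds visits place q once, and the unfinished
    one does so if q lies before j. *)
Lemma count_modn_iota s q r j : (q < s)%N -> (j <= s)%N ->
  count (fun i => i %% s == q)%N (iota 0 (r * s + j)) = (r + (q < j))%N.
Proof.
move=> qs js; elim: r => [|r IH].
  rewrite mul0n !add0n (@eq_in_count _ _ (pred1 q)).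
    by rewrite count_uniq_mem ?iota_uniq // mem_iota.
  by move=> i; rewrite mem_iota /= => ij; rewrite modn_small //; lia.
rewrite mulSn -addnA iotaD count_cat add0n -[in RHS]add1n -addnA; congr (_ + _)%N.
  rewrite (@eq_in_count _ _ (pred1 q)).
    by rewrite count_uniq_mem ?iota_uniq // mem_iota qs.
  by move=> i; rewrite mem_iota /= => ij; rewrite modn_small.
rewrite -[X in iota X]addn0 iotaDl count_map -IH; apply: eq_count => i /=.
by rewrite modnDl.
Qed.

Lemma count_extra (T : eqType) (P Q : pred T) (l : seq T) i : (forall x, Q x -> P x) ->
  i \in l -> P i -> ~~ Q i -> (count Q l < count P l)%N.
Proof.
move=> QP il Pi Qi.
rewrite -(size_filter P l) -(count_predC Q (filter P l)) !count_filter.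
have -> : count (predI Q P) l = count Q l.
  by apply: eq_count => x /=; case Qx: (Q x) => //=; rewrite QP.
rewrite -[X in (X < _)%N]addn0 ltn_add2l -has_count; apply/hasP; exists i => //=.
by rewrite Qi.
Qed.

Lemma sum_bool_leq N (b : nat -> bool) (l : seq nat) : (forall k, k < N -> b k -> k \in l)%N ->
  (\sum_(k < N) b k <= size l)%N.
Proof.
move=> h; rewrite -(big_mkord xpredT (fun k => nat_of_bool (b k))).
rewrite -big_mkcond /= sum1_count -size_filter; apply: uniq_leq_size.
  by rewrite filter_uniq // iota_uniq.
by move=> k; rewrite mem_filter mem_index_iota => /andP[bk /h]; apply.
Qed.

Section Counting.
Variables (K : closedFieldType) (n : nat) (X : 'I_n -> 'rV[K]_3).
Hypothesis XP : proj_points X.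

Lemma lines_dH m k (Fs S : seq 'rV[K]_3) (V : nat -> nat) :
  (1 < m * k)%N ->
  (forall L, L \in Fs -> L != 0) ->
  pairwise (fun L L' => ~~ (L == L')%MS) Fs -> all (full X k) Fs -> (size Fs <= m * k)%N ->
  (forall L : 'rV_3, L != 0 -> full X k L -> exists2 L', L' \in Fs & (L == L')%MS) ->
  (forall L, L \in S -> L != 0) -> (forall p, m <= hits X S p)%N ->
  (forall j, V j = line_degree X (nth 0%R S j) (fun p => m - hits X (take j S) p)%N) ->
  (forall j, j < size S -> V j + j <= m * k)%N ->
  (\sum_(j < size S) (V j + j == m * k) <= size Fs)%N ->
  dH_eq_lines X m k.
Proof.
move=> mk F0 Fpw Ffull Fs_mk Fcomp S0 mS VE VS Vc; exists (size Fs); split; last first.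
  exact: (reduction_dHF XP mk F0 Fpw Ffull Fs_mk S0 mS VE VS Vc).
exists (fun j => nth 0 Fs j); split=> [j|j j' jj'|j|L L0 Lk].
- by apply/F0/mem_nth.
- have h (a b : 'I_(size Fs)) : (a < b)%N -> ~~ (nth 0 Fs a == nth 0 Fs b)%MS.
    by move=> ab; have /(pairwiseP 0) := Fpw; apply => //; rewrite inE.
  case: (ltngtP j j') => e; [exact: h| |by case/negP: jj'; apply/eqP/val_inj].
  by rewrite andbC; apply: h.
- by apply/eqP; have /allP := Ffull; apply; apply: mem_nth.
have [|L' L'F LL'] := Fcomp L L0; first exact/eqP.
have iF : (index L' Fs < size Fs)%N by rewrite index_mem.
by exists (Ordinal iF); rewrite /= nth_index.
Qed.

Lemma on_line_eqmx (P L L' : 'rV[K]_3) : (L == L')%MS -> on_line P L = on_line P L'.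
Proof.
have h (A B : 'rV[K]_3) : (A <= B)%MS -> on_line P B -> on_line P A.
  case/sub_rVP => a ->; rewrite /on_line => /eqP PB.
  by rewrite linearZ -scalemxAr mxE PB mulr0.
by case/andP => LL' L'L; apply/idP/idP; apply: h.
Qed.

(** The configuration in order of removal: [rk p] is the place of the line to whose class p belongs,
    and by [M_rk] the line [M j] contains only points of rank at most j. The bounds [class_le] and
    [class_ge] stand for d_(s-j) <= d_s - j and d_(s-j) >= s - j. *)
Variables (s dd : nat) (M : nat -> 'rV[K]_3) (rk : 'I_n -> nat).
Hypothesis s_gt0 : (0 < s)%N.
Hypothesis rk_lt : forall p, (rk p < s)%N.
Hypothesis M0 : forall j, (j < s)%N -> M j != 0.
Hypothesis Mdist : forall i j, (i < s)%N -> (j < s)%N -> i != j -> ~~ (M i == M j)%MS.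
Hypothesis M_on : forall p, on_line (X p) (M (rk p)).
Hypothesis M_rk : forall p j, (j < s)%N -> on_line (X p) (M j) -> (rk p <= j)%N.
Hypothesis class_le : forall j, (j < s)%N -> (#|[pred p | rk p == j]| + j <= dd)%N.
Hypothesis class_ge : forall j, (j < s)%N -> (s <= #|[pred p | rk p == j]| + j)%N.

Definition npts (L : 'rV[K]_3) := #|[pred p | on_line (X p) L]|.
Definition npts_lt (L : 'rV[K]_3) j := #|[pred p | on_line (X p) L & (rk p < j)%N]|.
Definition npts_ge (L : 'rV[K]_3) j := #|[pred p | on_line (X p) L & (j <= rk p)%N]|.

Lemma nptsE L j : npts L = (npts_lt L j + npts_ge L j)%N.
Proof.
rewrite /npts /npts_lt /npts_ge -(cardID [pred p | (rk p < j)%N]); congr (_ + _)%N; apply: eq_card => p;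
 by rewrite !inE ?andbA -?leqNgt // andbC.
Qed.

Lemma fullE L : full X dd L = (npts L == dd).
Proof. by rewrite /full /npts; congr (_ == _); apply: eq_card => p; rewrite !inE. Qed.

(** A point of rank i lies on [M i], which L, being a different line, meets in at most one point of
    X. This allows one point for each rank from a to j - 1. *)
Lemma npts_between (L : 'rV[K]_3) a j : L != 0 -> (j <= s)%N ->
  (forall i, (i < j)%N -> ~~ (L == M i)%MS) ->
  (#|[pred p | on_line (X p) L & (a <= rk p < j)%N]| <= j - a)%N.
Proof.
move=> L0; elim: j => [|j IH] js hL.
  by rewrite eq_card0 // => p; rewrite !inE ltn0 !andbF.
have [ja|aj] := ltnP j a.
  by rewrite eq_card0 // => p; rewrite !inE; apply/negbTE; rewrite negb_and; apply/orP; right; lia.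
rewrite -(cardID [pred p | (rk p < j)%N]) subSn // -[X in (_ <= X)%N]addn1; apply: leq_add.
  apply: leq_trans (IH _ _); [|lia|by move=> i ij; apply: hL; lia].
  apply: subset_leq_card; apply/subsetP => p; rewrite !inE.
  by move=> /andP[/and3P[-> -> _] ->].
apply: leq_trans (card_line_cap XP L0 (M0 js) (hL j (ltnSn j))).
apply: subset_leq_card; apply/subsetP => p; rewrite !inE => /and4P[h1 -> h2 h3] /=.
by have <- : rk p = j by lia.
Qed.

Lemma npts_lt_leq L j : L != 0 -> (j <= s)%N -> (forall i, (i < j)%N -> ~~ (L == M i)%MS) ->
  (npts_lt L j <= j)%N.
Proof. by move=> L0 js hL; have := npts_between 0 L0 js hL; rewrite subn0. Qed.

Lemma npts_M j : (j < s)%N -> (npts_lt (M j) j <= j)%N /\ (npts_ge (M j) j + j <= dd)%N.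
Proof.
move=> js; split.
  apply: npts_lt_leq => //; [exact: M0|exact: ltnW|].
  by move=> i ij; apply: Mdist => //; [exact: ltn_trans js|rewrite neq_ltn ij orbT].
apply: leq_trans (class_le js); rewrite leq_add2r.
apply: subset_leq_card; apply/subsetP => p; rewrite !inE => /andP[pM jp].
by rewrite eqn_leq jp M_rk.
Qed.

(* With g = dd - npts L and e = npts_lt L j, the hypothesis on npts_ge says e + g >= j;
   the e points of smaller rank have been hit once more in the current round. *)
Lemma line_degree_bound L m r j (c x : 'I_n -> nat) : (r < m)%N -> (npts L <= dd)%N ->
  (npts_ge L j + j <= dd)%N ->
  (forall p, on_line (X p) L -> r + (rk p < j) + x p <= c p)%N ->
  (forall p, on_line (X p) L -> r + (rk p < j) + x p <= m)%N ->
  (line_degree X L (fun p => m - c p) + (r * dd + j) + (m - r - 1) * (dd - npts L)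
   + \sum_(p | on_line (X p) L) x p <= m * dd)%N.
Proof.
move=> rm ad bd hc hm.
have h : (line_degree X L (fun p => m - c p) + (r * npts L + npts_lt L j + \sum_(p | on_line (X p) L) x p)
   <= m * npts L)%N.
  have -> : (m * npts L = \sum_(p | on_line (X p) L) m)%N by rewrite sum_nat_const mulnC.
  have -> : (r * npts L = \sum_(p | on_line (X p) L) r)%N by rewrite sum_nat_const mulnC.
  have -> : npts_lt L j = (\sum_(p | on_line (X p) L) (rk p < j))%N.
    by rewrite /npts_lt -sum1_card big_mkcondr; apply: eq_bigr => p _; case: ltnP.
  rewrite /line_degree -!big_split /=; apply: leq_sum => p pL.
  by have := hc p pL; have := hm p pL; lia.
rewrite (nptsE L j) in ad h *.
move: (npts_lt L j) (npts_ge L j) (line_degree _ _ _) (\sum_(_ | _) _)%N ad bd h => e b v y ad bd h.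
have [g gE] : exists g, dd = (e + b + g)%N by exists (dd - (e + b))%N; lia.
have [t tE] : exists t, m = (r + t.+1)%N by exists (m - r - 1)%N; lia.
have -> : (dd - (e + b) = g)%N by lia.
have -> : (m - r - 1 = t)%N by lia.
have jeg : (j <= e + g)%N by lia.
move: h; rewrite gE tE; clear -jeg => h.
nia.
Qed.

Lemma hits_mkseq F k p : hits X (mkseq F k) p = count (fun i => on_line (X p) (F i)) (iota 0 k).
Proof. by rewrite /hits /mkseq count_map. Qed.

Lemma hits_mkseq_ge F r j p : (j <= s)%N -> (forall i, i %% s = rk p -> on_line (X p) (F i))%N ->
  (r + (rk p < j) <= hits X (mkseq F (r * s + j)) p)%N.
Proof.
move=> js hF; rewrite hits_mkseq -(count_modn_iota r (rk_lt p) js).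
by apply: sub_count => i /eqP; apply: hF.
Qed.

Lemma hits_mkseq_gt F r j p i0 : (j <= s)%N -> (forall i, i %% s = rk p -> on_line (X p) (F i))%N ->
  (i0 < r * s + j)%N -> (i0 %% s)%N != rk p -> on_line (X p) (F i0) ->
  (r + (rk p < j) + 1 <= hits X (mkseq F (r * s + j)) p)%N.
Proof.
move=> js hF i0k i0r i0F; rewrite hits_mkseq -(count_modn_iota r (rk_lt p) js) addn1.
apply: (@count_extra _ _ _ _ i0) => //; first by move=> i /eqP; apply: hF.
by rewrite mem_iota.
Qed.

Lemma take_mkseq (T : Type) (F : nat -> T) k N : (k <= N)%N -> take k (mkseq F N) = mkseq F k.
Proof. by move=> kN; rewrite /mkseq -map_take take_iota (minn_idPl kN). Qed.

Lemma full_pairwise (l : seq 'rV[K]_3) : pairwise (fun L L' => ~~ (L == L')%MS) l ->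
  pairwise (fun L L' => ~~ (L == L')%MS) (filter (full X dd) l).
Proof. by move=> h; apply: subseq_pairwise (filter_subseq _ _) h. Qed.

(* S consists of m rounds M 0, ..., M s.-1; only in round 0 can the budget be met exactly. *)
Lemma dH_large m : (s < dd)%N -> (2 <= m)%N -> dH_eq_lines X m dd.
Proof.
move=> sdd m2.
pose S := mkseq (fun k => M (k %% s)) (m * s).
pose Fs := filter (full X dd) (mkseq M s).
have SS : size S = (m * s)%N by rewrite size_mkseq.
pose Vf k := line_degree X (nth 0%R S k) (fun p => m - hits X (take k S) p)%N.
have key k : (k < m * s)%N ->
    (Vf k + k <= m * dd)%N /\ ((Vf k + k)%N = (m * dd)%N -> (k < s)%N /\ full X dd (M k)).
  move=> kms.
  pose r := (k %/ s)%N; pose j := (k %% s)%N.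
  have kE : k = (r * s + j)%N := divn_eq k s.
  have js : (j < s)%N by rewrite ltn_mod.
  have rm : (r < m)%N by rewrite ltn_divLR.
  have [hlt hge] := npts_M js.
  have ndd : (npts (M j) <= dd)%N by rewrite (nptsE _ j); lia.
  have h := @line_degree_bound (M j) m r j (hits X (take k S)) (fun=> 0%N) rm ndd hge _ _.
  have {}h := h _ _; have hc p : on_line (X p) (M j) -> (r + (rk p < j) + 0 <= hits X (take k S) p)%N.
    move=> _; rewrite addn0 take_mkseq; last exact: ltnW.
    rewrite kE; apply: hits_mkseq_ge; first exact: ltnW.
    by move=> i ->.
  have {}h := h hc _; have hm p : on_line (X p) (M j) -> (r + (rk p < j) + 0 <= m)%N.
    by move=> _; case: ltnP; lia.
  have {h} := h hm; rewrite big1 // addn0.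
  have -> : line_degree X (M j) (fun p => m - hits X (take k S) p)%N = Vf k by rewrite /Vf nth_mkseq.
  (* The estimate credits r rounds with r dd, while the step index contains only r s. Since s < dd
     this excludes equality for r > 0; for r = 0 the weight m - 1 > 0 on the missing points excludes
     it unless the line is full. *)
  have : (k <= r * dd + j)%N by rewrite {1}kE leq_add2r leq_mul2l (ltnW sdd) orbT.
  have e1 : (0 < r -> k < r * dd + j)%N.
    by move=> r0; rewrite {1}kE ltn_add2r ltn_pmul2l.
  have e2 : (npts (M j) != dd)%N -> (r = 0 -> 0 < (m - r - 1) * (dd - npts (M j)))%N.
    by move=> nd r0; rewrite muln_gt0; move: (npts _) ndd nd => N; lia.
  move: (Vf k) ((m - r - 1) * _)%N (r * dd)%N (m * dd)%N e1 e2 => V y rd md e1 e2 hk h; split; first by lia.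
  move=> e; have r0 : r = 0%N.
    by apply/eqP; rewrite -leqn0 leqNgt; apply/negP => /e1; lia.
  have jk : k = j by rewrite kE r0 mul0n.
  split; first by rewrite jk.
  rewrite jk fullE; apply: contraT => nd; have := e2 nd r0; lia.
apply: (@lines_dH m dd Fs S Vf) => //.
- by nia.
- move=> L; rewrite mem_filter => /andP[_ /mapP[k]]; rewrite mem_iota => /= ks ->; exact: M0.
- apply: full_pairwise; apply/(pairwiseP 0) => i j; rewrite !inE size_mkseq => im jm ij.
  by rewrite !nth_mkseq //; apply: Mdist => //; rewrite neq_ltn ij.
- exact: filter_all.
- rewrite size_filter; apply: leq_trans (count_size _ _) _; rewrite size_mkseq.
  by nia.
- move=> L L0; rewrite fullE => /eqP Ldd.
  have [/hasP[k]|/hasPn hn] := boolP (has (fun k => (L == M k)%MS) (iota 0 s)).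
    rewrite mem_iota => /= ks LM; exists (M k) => //; rewrite mem_filter fullE.
    rewrite (map_f M) ?mem_iota // andbT -Ldd; apply/eqP/eq_card => p; rewrite !inE.
    by rewrite (on_line_eqmx _ LM).
  (* A line different from all [M i] has at most s < dd points, so it is not full. *)
  have : (npts_lt L s <= s)%N.
    by apply: npts_lt_leq => // i im; apply: hn; rewrite mem_iota.
  have : npts_lt L s = npts L by apply: eq_card => p; rewrite !inE rk_lt andbT.
  by move=> ->; lia.
- move=> L /mapP[k _ ->]; apply: M0; exact: ltn_pmod.
- move=> p; have := @hits_mkseq_ge (fun k => M (k %% s)%N) m 0 p (leq0n s).
  by rewrite !addn0; apply => i ->.
- by move=> k; rewrite SS => /key[].
rewrite SS.
apply: (@leq_trans (size (filter (fun k => full X dd (M k)) (iota 0 s)))).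
  apply: (@sum_bool_leq _ (fun k => Vf k + k == m * dd)%N).
  move=> k /key[_ h] /eqP /h[ks fk]; rewrite mem_filter fk mem_iota; exact: ks.
by rewrite /Fs /mkseq filter_map size_map.
Qed.


(* Since M s.-1 only has to contain the single point p1 of its class, in round r
   it is replaced by the line through p1 and the r-th point Q r of M 0. After
   s <= m - 1 rounds every point of M 0 has been hit one extra time, so M 0 is
   skipped in the last round. *)
Lemma dH_small m : dd = s -> (1 < s)%N -> (s < m)%N -> dH_eq_lines X m dd.
Proof.
move=> dds s1 sm.
have s1s : (s.-1 < s)%N by rewrite prednK.
(* As dd = s, class j has exactly s - j points: one in the last class and s in the class of
   [M 0]. *)
have [p1 p1E] : exists p, rk p = s.-1.
  have : (0 < #|[pred p | rk p == s.-1]|)%N by have := class_ge s1s; lia.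
  by case/card_gt0P => p /eqP; exists p.
have top_uniq p : rk p = s.-1 -> p = p1.
  move=> pE; have /card_le1_eqP h : (#|[pred p | rk p == s.-1]| <= 1)%N.
    by have := class_le s1s; rewrite dds; move: #|_| => c; lia.
  by apply: h; rewrite inE ?pE ?p1E.
have [Lp LpP] := fin_all_exists (line_through_exists X p1).
pose Q i := nth p1 (enum [pred p | rk p == 0%N]) i.
have sQ : size (enum [pred p | rk p == 0%N]) = s.
  rewrite -cardE; have := class_le s_gt0; have := class_ge s_gt0; rewrite dds.
  by move: #|_| => c; lia.
have Q0 i : (i < s)%N -> rk (Q i) = 0%N.
  by move=> si; apply/eqP; have : Q i \in enum [pred p | rk p == 0%N]; [apply: mem_nth; rewrite sQ|rewrite mem_enum].
have Qsurj p : rk p = 0%N -> exists2 i, (i < s)%N & p = Q i.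
  move=> p0; have pQ : p \in enum [pred p | rk p == 0%N] by rewrite mem_enum inE p0.
  by exists (index p (enum [pred p | rk p == 0%N])); rewrite -?sQ ?index_mem // /Q nth_index.
have Qinj i j : (i < s)%N -> (j < s)%N -> i != j -> Q i != Q j.
  by move=> si sj ij; rewrite nth_uniq ?sQ ?enum_uniq.
(* For [i >= s] the line through [Q 0] is repeated. That point has had its extra hit in round 0,
   which keeps these later steps below the budget. *)
pose N i := Lp (Q (if (i < s)%N then i else 0%N)).
have N0 i : N i != 0 by case: (LpP (Q (if (i < s)%N then i else 0%N))).
have Np1 i : on_line (X p1) (N i) by case: (LpP (Q (if (i < s)%N then i else 0%N))).
have NQ i : on_line (X (Q (if (i < s)%N then i else 0%N))) (N i).
  by case: (LpP (Q (if (i < s)%N then i else 0%N))).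
have NQs i : (i < s)%N -> on_line (X (Q i)) (N i) by move=> si; have := NQ i; rewrite si.
have NM i j : (j < s.-1)%N -> ~~ (N i == M j)%MS.
  move=> js; apply/negP => e; have js' : (j < s)%N by lia.
  have := M_rk (p := p1) js'; rewrite -(on_line_eqmx _ e) Np1 p1E => /(_ isT); lia.
have NN i j : (i < s)%N -> (j < s)%N -> i != j -> ~~ (N i == N j)%MS.
  move=> si sj ij; apply/negP => e; have h0 : (0 < s.-1)%N by lia.
  case/negP: (NM i 0%N h0).
  have M0on k : (k < s)%N -> on_line (X (Q k)) (M 0%N).
    by move=> sk; rewrite -(Q0 k sk); apply: M_on.
  apply: (line_through_inj XP (N0 i) (M0 s_gt0) (Qinj i j si sj ij)); rewrite ?M0on ?NQs //.
  by rewrite (on_line_eqmx _ e) NQs.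
have nN i : (npts_lt (N i) s.-1 <= s.-1)%N /\ (npts_ge (N i) s.-1 + s.-1 <= dd)%N.
  split; first by apply: npts_lt_leq => //; [exact: ltnW|move=> j; apply: NM].
  apply: leq_trans (class_le s1s); rewrite leq_add2r.
  apply: subset_leq_card; apply/subsetP => p; rewrite !inE => /andP[_ h].
  by have := rk_lt p; lia.
(* There are m - 1 full rounds, with [N r] at the end of round r, and then a last round without
   [M 0]: m s - 1 steps in all. *)
pose F k := if (k %% s == s.-1)%N then N (k %/ s)%N else M (k %% s)%N.
pose G j := if j == s.-1 then N 0%N else M j.
pose S1 := mkseq F (m.-1 * s); pose S2 := map G (iota 1 s.-1).
pose S := S1 ++ S2.
pose Vf k := line_degree X (nth 0%R S k) (fun p => m - hits X (take k S) p)%N.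
have sS1 : size S1 = (m.-1 * s)%N by rewrite size_mkseq.
have sS : size S = (m.-1 * s + s.-1)%N by rewrite size_cat sS1 size_map size_iota.
have hF p i : (i %% s)%N = rk p -> on_line (X p) (F i).
  by rewrite /F => ->; case: eqP => [/top_uniq ->|_] //; apply: M_on.
have hG p : on_line (X p) (G (rk p)).
  by rewrite /G; case: eqP => [/top_uniq ->|_] //; apply: M_on.
have modj r j : (j < s)%N -> ((r * s + j) %% s)%N = j.
  by move=> js; rewrite modnMDl modn_small.
have divj r j : (j < s)%N -> ((r * s + j) %/ s)%N = r.
  by move=> js; rewrite divnMDl // divn_small // addn0.
have Ftop r : F (r * s + s.-1)%N = N r by rewrite /F modj // eqxx divj.
have Flow j : (j < s.-1)%N -> F j = M j.
  by move=> js; rewrite /F modn_small; [case: eqP; [lia|]|lia].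
have c1 p : (m.-1 <= hits X S1 p)%N.
  by have := @hits_mkseq_ge F m.-1 0 p (leq0n s) (hF p); rewrite !addn0.
have c0 p : rk p = 0%N -> (m <= hits X S1 p)%N.
  move=> p0; have [i si pE] := Qsurj p p0.
  (* Round i is among the first m - 1 because i < s <= m - 1; this is what [s < m] is for. *)
  have lt : (i * s + s.-1 < m.-1 * s + 0)%N.
    have h : (i.+1 * s <= m.-1 * s)%N by rewrite leq_mul2r; apply/orP; right; lia.
    by rewrite addn0; apply: leq_trans h; rewrite mulSn addnC ltn_add2r; lia.
  have := hits_mkseq_gt (leq0n s) (hF p) lt; rewrite modj // p0 Ftop pE NQs // ltn0 addn0.
  move=> h; apply: leq_trans (h _ isT); first by lia.
  by lia.
have key1 k : (k < m.-1 * s)%N -> (Vf k + k <= m * dd)%N /\ ((Vf k + k)%N = (m * dd)%N ->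
    (k < s.-1)%N /\ full X dd (M k) \/
    (exists2 r, (r < s)%N /\ full X dd (N r) & k = r * s + s.-1)%N).
  move=> ks; pose r := (k %/ s)%N; pose j := (k %% s)%N.
  have kE : k = (r * s + j)%N := divn_eq k s.
  have js : (j < s)%N by rewrite ltn_mod.
  have rm : (r < m.-1)%N by rewrite ltn_divLR.
  have VE : Vf k = line_degree X (F k) (fun p => m - hits X (mkseq F k) p)%N.
    by rewrite /Vf /S nth_cat take_cat sS1 ks nth_mkseq // take_mkseq // ltnW.
  have FE : F k = if j == s.-1 then N r else M j by [].
  have [hlt hge] : (npts_lt (F k) j <= j)%N /\ (npts_ge (F k) j + j <= dd)%N.
    by rewrite FE; case: eqP => [->|_]; [exact: nN|exact: npts_M].
  have ndd : (npts (F k) <= dd)%N by rewrite (nptsE _ j); lia.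
  have hc p : (r + (rk p < j) <= hits X (mkseq F k) p)%N.
    by rewrite {1}kE; apply: hits_mkseq_ge; [exact: ltnW|exact: hF].
  have rm' : (r < m)%N by lia.
  have kdd : (r * dd + j)%N = k by rewrite dds.
  have hbase : (Vf k + k + (m - r - 1) * (dd - npts (F k)) <= m * dd)%N.
    have hc0 p : on_line (X p) (F k) -> (r + (rk p < j) + 0 <= hits X (mkseq F k) p)%N.
      by rewrite addn0.
    have hm0 p : on_line (X p) (F k) -> (r + (rk p < j) + 0 <= m)%N by case: ltnP; lia.
    by have := line_degree_bound rm' ndd hge hc0 hm0; rewrite big1 // addn0 -VE kdd.
  (* A point of the current line with an extra hit, made by a step [i0] outside its own place,
     improves the bound by one. *)
  have hstrict p0 i0 : on_line (X p0) (F k) -> (i0 < k)%N -> (i0 %% s)%N != rk p0 ->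
      on_line (X p0) (F i0) -> (Vf k + k < m * dd)%N.
    move=> p0k i0k i0p p0i.
    have hc1 p : on_line (X p) (F k) -> (r + (rk p < j) + (p == p0) <= hits X (mkseq F k) p)%N.
      move=> _; case: eqP => [->|_]; last by rewrite addn0.
      rewrite {1}kE; apply: (hits_mkseq_gt _ (hF p0) _ i0p p0i); first exact: ltnW.
      by rewrite -kE.
    have hm1 p : on_line (X p) (F k) -> (r + (rk p < j) + (p == p0) <= m)%N.
      by case: ltnP; case: eqP; lia.
    have := line_degree_bound rm' ndd hge hc1 hm1; rewrite -VE kdd (bigD1 p0) //= eqxx.
    by move: (_ * (_ - _))%N (\sum_(_ | _) _)%N (Vf k) (m * dd)%N => y x v q; lia.
  split; first by apply: leq_trans hbase; apply: leq_addr.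
  (* Before the last round the weight m - r - 1 is positive, so equality forces a full line. *)
  move=> e; have hfull : full X dd (F k).
    rewrite fullE; apply: contraT => nd.
    have : (0 < (m - r - 1) * (dd - npts (F k)))%N.
      by rewrite muln_gt0; move: (npts _) ndd nd => q; lia.
    by move: hbase; rewrite e; move: (_ * (_ - _))%N (m * dd)%N => y q; lia.
  have nstrict p0 i0 : on_line (X p0) (F k) -> (i0 < k)%N -> (i0 %% s)%N != rk p0 ->
      on_line (X p0) (F i0) -> False.
    by move=> h1 h2 h3 h4; have := hstrict p0 i0 h1 h2 h3 h4; rewrite e ltnn.
  have s1s0 : (s.-1 %% s != 0)%N by rewrite modn_small; lia.
  have F1 : F s.-1 = N 0%N by have := Ftop 0%N; rewrite mul0n add0n.
  have [js1|js1] := eqVneq j s.-1.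
    right; have Fk : F k = N r by rewrite FE js1 eqxx.
    have [rs|rs] := ltnP r s; first by exists r; rewrite -?Fk // kE js1.
    case: (nstrict (Q 0%N) s.-1).
    + by have := NQ r; rewrite ltnNge rs Fk.
    + rewrite kE js1 -[X in (X < _)%N]add0n ltn_add2r muln_gt0; lia.
    + by rewrite Q0.
    + by rewrite F1 NQs.
  left; have Fk : F k = M j by rewrite FE (negPf js1).
  have [r0|r0] := eqVneq r 0%N.
    have jk : k = j by rewrite kE r0 mul0n.
    by split; [lia|rewrite jk -Fk].
  have sk : (s <= k)%N.
    have h : (1 * s <= r * s)%N by rewrite leq_mul2r; apply/orP; right; lia.
    by rewrite mul1n in h; rewrite kE; apply: leq_trans h (leq_addr _ _).
  (* In a later round [M 0] contains [Q 0], which [N 0] has hit additionally in round 0. *)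
  have [j0|j0] := eqVneq j 0%N.
    case: (nstrict (Q 0%N) s.-1).
    + by have := M_on (Q 0%N); rewrite Q0 // Fk j0.
    + lia.
    + by rewrite Q0.
    + by rewrite F1 NQs.
  (* The full line [M j] has at most dd - j points of rank at least j, hence also one of smaller
     rank; [F j], which is [M j], has hit that point additionally in round 0. *)
  have : (0 < npts_lt (F k) j)%N.
    by move: hfull; rewrite fullE (nptsE _ j) => /eqP; move: hge; move: (npts_lt _ _) (npts_ge _ _) => u v; lia.
  case/card_gt0P => p0; rewrite inE => /andP[p0k p0j].
  case: (nstrict p0 j) => //; first by lia.
    by rewrite modn_small //; lia.
  rewrite Flow; last by lia.
  by rewrite -Fk.
(* In the last round the weight m - r - 1 is 0 and fullness is invisible to the bound. Skipping
   [M 0] moves place j to index j - 1 of the round, which makes the bound strict. *)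
have key2 k : (k < s.-1)%N -> (Vf (m.-1 * s + k) + (m.-1 * s + k) < m * dd)%N.
  move=> ks; pose j := k.+1.
  have js : (j < s)%N by rewrite /j; lia.
  pose c := hits X (S1 ++ map G (iota 1 k)).
  have VE : Vf (m.-1 * s + k)%N = line_degree X (G j) (fun p => m - c p)%N.
    rewrite /Vf /S nth_cat take_cat sS1 ltnNge leq_addr /= addKn -map_take take_iota.
    rewrite (minn_idPl (ltnW ks)) (nth_map 0%N) ?size_iota // nth_iota //.
  have [hlt hge] : (npts_lt (G j) j <= j)%N /\ (npts_ge (G j) j + j <= dd)%N.
    by rewrite /G; case: eqP => [->|_]; [exact: nN|exact: npts_M].
  have ndd : (npts (G j) <= dd)%N by rewrite (nptsE _ j); lia.
  have hc0 p : on_line (X p) (G j) -> (m.-1 + (rk p < j) + 0 <= c p)%N.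
    move=> _; rewrite addn0 /c /hits count_cat -/(hits X S1 p).
    have [p0|p0] := eqVneq (rk p) 0%N.
      by have := c0 p p0; case: ltnP; lia.
    case: ltnP => pj; last by rewrite addn0; apply: leq_trans (c1 p) (leq_addr _ _).
    apply: leq_add; first exact: c1.
    rewrite -has_count; apply/hasP; exists (G (rk p)); last exact: hG.
    by apply: map_f; rewrite mem_iota; move: pj; rewrite /j; lia.
  have hm0 p : on_line (X p) (G j) -> (m.-1 + (rk p < j) + 0 <= m)%N by case: ltnP; lia.
  have rm : (m.-1 < m)%N by lia.
  have := line_degree_bound rm ndd hge hc0 hm0; rewrite VE dds big1 // addn0.
  move: (line_degree _ _ _) (_ * (s - _))%N (m.-1 * s)%N (m * s)%N => v y q q'.
  by rewrite /j; lia.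
pose Fs := filter (full X dd) (mkseq M s.-1 ++ mkseq N s).
apply: (@lines_dH m dd Fs S Vf) => //.
- by rewrite dds; nia.
- move=> L; rewrite mem_filter mem_cat => /andP[_ /orP[]] /mapP[k]; rewrite mem_iota => /= ks -> //.
  by apply: M0; lia.
- apply: full_pairwise; rewrite pairwise_cat; apply/and3P; split.
  + apply/allrelP => L L' /mapP[j]; rewrite mem_iota => /= js -> /mapP[i _ ->].
    by rewrite andbC; apply: NM.
  + apply/(pairwiseP 0) => i j; rewrite !inE size_mkseq => im jm ij.
    by rewrite !nth_mkseq //; apply: Mdist; lia.
  + apply/(pairwiseP 0) => i j; rewrite !inE size_mkseq => im jm ij.
    by rewrite !nth_mkseq //; apply: NN; rewrite // neq_ltn ij.
- exact: filter_all.
- rewrite size_filter; apply: leq_trans (count_size _ _) _; rewrite size_cat !size_mkseq.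
  by rewrite dds; nia.
- move=> L L0; rewrite fullE => /eqP Ldd.
  have inFs L' : L' \in mkseq M s.-1 ++ mkseq N s -> (L == L')%MS ->
      exists2 L', L' \in Fs & (L == L')%MS.
    move=> L's LL'; exists L' => //; rewrite mem_filter L's andbT fullE -Ldd.
    by apply/eqP/eq_card => p; rewrite !inE (on_line_eqmx _ LL').
  have [/hasP[k]|/hasPn hn] := boolP (has (fun k => (L == M k)%MS) (iota 0 s.-1)).
    rewrite mem_iota => /= ks LM; apply: (inFs (M k)) => //.
    by rewrite mem_cat (map_f M) ?mem_iota.
  have hn' i : (i < s.-1)%N -> ~~ (L == M i)%MS by move=> im; apply: hn; rewrite mem_iota.
  (* Among the s points of L at most s - 1 have rank below s - 1 and at most one, [p1], has rank s -
     1, so both bounds are attained. Ranks 1 to s - 2 supply at most s - 2 points, hence some point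
     has rank 0, and L is a line [N i]. *)
  have h1 : (npts_lt L s.-1 <= s.-1)%N by apply: npts_lt_leq => //; exact: ltnW.
  have h2 : (npts_ge L s.-1 <= 1)%N.
    have : (#|[pred p | rk p == s.-1]| <= 1)%N.
      by have := class_le s1s; rewrite dds; move: #|_| => c; lia.
    apply: leq_trans; apply: subset_leq_card; apply/subsetP => p; rewrite !inE => /andP[_ h].
    by have := rk_lt p; lia.
  have h3 := npts_between 1 L0 (ltnW s1s) hn'.
  have e := nptsE L s.-1; rewrite Ldd dds in e.
  have p1L : on_line (X p1) L.
    have : (0 < npts_ge L s.-1)%N by move: (npts_lt _ _) (npts_ge _ _) e h1 h2 => u v; lia.
    case/card_gt0P => p; rewrite inE => /andP[pL ps].
    by rewrite -(top_uniq p) //; have := rk_lt p; lia.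
  have [p [pL p0]] : exists p, on_line (X p) L /\ rk p = 0%N.
    have : (0 < #|[predI [pred p | on_line (X p) L & (rk p < s.-1)%N] & [pred p | rk p == 0%N]]|)%N.
      have := cardID [pred p | rk p == 0%N] [pred p | on_line (X p) L & (rk p < s.-1)%N].
      rewrite -/(npts_lt L s.-1) (_ : #|[predD _ & _]| = #|[pred p | on_line (X p) L & (1 <= rk p < s.-1)%N]|).
        by move: e h1 h2 h3; move: (npts_lt _ _) (npts_ge _ _) #|_| #|_| => u v w z; lia.
      by apply: eq_card => p; rewrite !inE; case: (rk p) => [|q]; rewrite ?andbF ?andbT.
    by case/card_gt0P => p; rewrite !inE => /andP[/andP[pL _] /eqP p0]; exists p.
  have [i si pE] := Qsurj p p0.
  apply: (inFs (N i)); first by rewrite mem_cat (map_f N) ?orbT // mem_iota.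
  apply: (line_through_inj XP L0 (N0 i) (p := p1) (q := p)) => //; last by rewrite pE NQs.
  by apply: contraTneq s1 => pp; move: p1E; rewrite pp p0; lia.
- move=> L; rewrite mem_cat => /orP[] /mapP[k].
    by move=> _ ->; rewrite /F; case: (k %% s == s.-1)%N => //; apply: M0; rewrite ltn_mod.
  by rewrite mem_iota => hk ->; rewrite /G; case: (k == s.-1)%N => //; apply: M0; lia.
- move=> p; rewrite /hits count_cat -/(hits X S1 p).
  have [p0|p0] := eqVneq (rk p) 0%N; first by apply: leq_trans (c0 p p0) (leq_addr _ _).
  have : (0 < count (on_line (X p)) S2)%N.
    rewrite -has_count; apply/hasP; exists (G (rk p)); last exact: hG.
    by apply: map_f; rewrite mem_iota; have := rk_lt p; lia.
  by have := c1 p; lia.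
- move=> k; rewrite sS => kS; have [/key1[]//|hk] := ltnP k (m.-1 * s).
  have [k' kE] : exists k', k = (m.-1 * s + k')%N by exists (k - m.-1 * s)%N; lia.
  by rewrite kE; apply/ltnW/key2; lia.
(* The steps at which equality is possible: the first visit to a full [M k] with k < s - 1, and the
   end of a round r < s with [N r] full. *)
pose l := filter (fun k => full X dd (M k)) (iota 0 s.-1) ++
   map (fun r => r * s + s.-1)%N (filter (fun k => full X dd (N k)) (iota 0 s)).
apply: (@leq_trans (size l)).
  apply: (@sum_bool_leq _ (fun k => Vf k + k == m * dd)%N) => k; rewrite sS => kS /eqP kE.
  have [/key1[_ /(_ kE) []]|hk] := ltnP k (m.-1 * s).
  - by move=> [ks fk]; rewrite mem_cat mem_filter fk mem_iota ks.
  - by move=> [r [rs fr] ->]; rewrite mem_cat; apply/orP; right; apply: map_f; rewrite mem_filter fr mem_iota.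
  have [k' k'E] : exists k', k = (m.-1 * s + k')%N by exists (k - m.-1 * s)%N; lia.
  have := key2 k'; rewrite -k'E; lia.
by rewrite /Fs filter_cat !size_cat /mkseq !filter_map !size_map.
Qed.

End Counting.

(** * From a configuration of given type to the theorem *)

Lemma sorted_ltn_nth_add (d : seq nat) i k : sorted ltn d -> (i + k < size d)%N ->
  (nth 0 d i + k <= nth 0 d (i + k))%N.
Proof.
move=> sd; elim: k => [|k IH] h; first by rewrite !addn0.
rewrite addnS; apply: leq_ltn_trans (IH _) _; first by lia.
by rewrite addnS; apply: (sorted_ltn_nth ltn_trans) => //; rewrite ?inE; lia.
Qed.

(* Lines and classes are renumbered in the order in which they are removed:
   M j is the paper's L_(s - j), and rk p = j when p lies in X_(s - j). *)
Lemma kconfig_data (K : closedFieldType) n (X : 'I_n -> 'rV[K]_3) d : is_kconfig X d ->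
  exists (M : nat -> 'rV[K]_3) (rk : 'I_n -> nat), let s := size d in let dd := last 0%N d in
  [/\ (forall p, (rk p < s)%N) /\ (forall j, (j < s)%N -> M j != 0),
      forall i j, (i < s)%N -> (j < s)%N -> i != j -> ~~ (M i == M j)%MS,
      forall p, on_line (X p) (M (rk p)),
      forall p j, (j < s)%N -> on_line (X p) (M j) -> (rk p <= j)%N &
      (forall j, (j < s)%N -> (#|[pred p | rk p == j]| + j <= dd)%N) /\
      (forall j, (j < s)%N -> (s <= #|[pred p | rk p == j]| + j)%N)].
Proof.
case=> [[d0 h0 sd] [Xs [L [[cov card] L0 Ldist on off]]]].
(* Reversal of the numbering. The index is always below [size d], so the default value is never
   returned. *)
pose io j : 'I_(size d) := insubd (Ordinal d0) ((size d).-1 - j)%N.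
have ioE j : io j = ((size d).-1 - j)%N :> nat by rewrite val_insubd; case: ifP => //; lia.
have /fin_all_exists[cl clP] : forall p, exists i, p \in Xs i.
  move=> p; have : p \in \bigcup_(i < size d) Xs i by rewrite cov inE.
  by case/bigcupP => i _; exists i.
(* The classes are disjoint: a point of X_j and X_i with j < i would lie on L_i, which misses
   X_j. *)
have cl_uniq p i : p \in Xs i -> cl p = i.
  move=> pi; apply/val_inj => /=; case: (ltngtP (cl p) i) => // h.
    by have := off i (cl p) h p (clP p); rewrite (on _ _ pi).
  by have := off (cl p) i h p pi; rewrite (on _ _ (clP p)).
pose rk p := ((size d).-1 - cl p)%N.
have iork p : io (rk p) = cl p.
  by apply/val_inj; rewrite /= ioE /rk; have := ltn_ord (cl p); lia.
have cardE j : (j < size d)%N -> #|[pred p | rk p == j]| = nth 0%N d ((size d).-1 - j).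
  move=> js; rewrite -ioE -card; apply: eq_card => p; rewrite !inE.
  apply/eqP/idP => [<-|pj]; first by rewrite iork.
  by rewrite /rk (cl_uniq _ _ pj) ioE; lia.
exists (fun j => L (io j)), rk; split; [split|..].
- by move=> p; rewrite /rk; lia.
- by move=> j _; apply: L0.
- move=> i j si sj ij; apply: Ldist; apply: contra ij => /eqP/(congr1 val) /=.
  by rewrite !ioE => h; apply/eqP; lia.
- by move=> p; rewrite iork; apply/on/clP.
- move=> p j js pj; rewrite leqNgt; apply/negP => h.
  have lt : (cl p < io j)%N by rewrite ioE; move: h; rewrite /rk; lia.
  by have := off _ _ lt p (clP p); rewrite pj.
split=> j js; rewrite cardE //.
  have h := @sorted_ltn_nth_add d ((size d).-1 - j) j sd _.
  rewrite -nth_last -[X in (_ <= nth _ _ X)%N](_ : (size d).-1 - j + j = (size d).-1)%N; last by lia.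
  by apply: h; lia.
have h := @sorted_ltn_nth_add d 0 ((size d).-1 - j) sd _.
have : (nth 0 d 0 + ((size d).-1 - j) <= nth 0 d (0 + ((size d).-1 - j)))%N by apply: h; lia.
by rewrite add0n nth0; move: (nth _ _ _) => v; lia.
Qed.

Theorem theorem1p2 (K : closedFieldType) (n : nat) (X : 'I_n -> 'rV[K]_3)
    (d : seq nat) :
  proj_points X -> is_kconfig X d -> d != [:: 1%N] ->
  [/\ exists m0 : nat, forall m : nat, (m0 <= m)%N -> dH_eq_lines X m (last 0%N d),
      (size d < last 0%N d)%N ->
        forall m : nat, (2 <= m)%N -> dH_eq_lines X m (last 0%N d) &
      last 0%N d = size d ->
        forall m : nat, ((size d).+1 <= m)%N -> dH_eq_lines X m (last 0%N d)].
Proof.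
move=> XP kX d1.
have s_gt0 : (0 < size d)%N by case: kX => [[]].
have [M [rk [[rk_lt M0] Mdist M_on M_rk [cl_le cl_ge]]]] := kconfig_data kX.
have s_le : (size d <= last 0%N d)%N.
  by have := cl_le 0%N s_gt0; have := cl_ge 0%N s_gt0; move: #|_| => c; lia.
have large : (size d < last 0%N d)%N ->
    forall m : nat, (2 <= m)%N -> dH_eq_lines X m (last 0%N d).
  by move=> sd m m2; apply: (dH_large XP s_gt0 rk_lt M0 Mdist M_on M_rk cl_le).
have small : last 0%N d = size d ->
    forall m : nat, ((size d).+1 <= m)%N -> dH_eq_lines X m (last 0%N d).
  move=> sd m ms; apply: (dH_small XP s_gt0 rk_lt M0 Mdist M_on M_rk cl_le cl_ge) => //.
  (* With s = 1 = d_s the type would be (1). *)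
  by case: d d1 s_gt0 sd {kX M0 Mdist M_rk cl_le cl_ge s_le large ms rk_lt} => [//|a [|//]] /= d1 _ a1; case/eqP: d1; rewrite a1.
split=> //; have [sd|ds] := ltnP (size d) (last 0%N d); first by exists 2; apply: large.
by exists (size d).+1; apply: small; apply/eqP; rewrite eqn_leq ds s_le.
Qed.
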